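(* Let $G$ be a finite simple graph with at least one vertex, let $s \geq 1$ be an integer, and let $u \in V(G)$ be a vertex with $c(u) = \max\{c(v) \mid v \in V(G)\}$ (so $c(u)$ is the circumference of $G$ when $G$ contains a cycle). Then \[ N(G,K_s) \leq \left(\sum_{v\in V(G)}\frac{1}{c(v)-1}\binom{c(v)}{s}\right) - \frac{1}{c(u)-1}\binom{c(u)}{s}. \] If $s=1$, equality holds if and only if $G$ is Hamiltonian. Otherwise (i.e. for $s \geq 2$), equality holds if and only if the induced subgraph $G[H_c]$ is a parent-dominated block graph, where $H_c = \{v \in V(G) \mid c(v) \geq s\}$.
   Context: $N(G,K_s)$ denotes the number of subgraphs of $G$ isomorphic to the complete graph $K_s$. For $v \in V(G)$, $c(v)$ is the length of the longest cycle of $G$ containing $v$, and $c(v)=2$ if $v$ lies on no cycle. Binomial coefficients $\binom{a}{b}$ are $0$ when $a<b$. A block of a graph is a maximal connected subgraph without cut-vertices; a block graph is a connected graph in which every block is a clique. The block tree of a block graph has one vertex per block, two blocks being adjacent iff they share a vertex. A block graph is a parent-dominated block graph if its block tree can be rooted at a block of largest order so that every non-root block has order at most the order of its parent block.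
   Formalization: For s=1 the inequality excludes the one-vertex graph (bound is 0 but N=1) and the equality criterion excludes two-vertex graphs (equality holds, no Hamiltonian cycle); for s>=2 an empty G[H_c] counts as a parent-dominated block graph, since both sides are then 0. *)

(* Defs.v *)
From mathcomp Require Import all_boot all_order all_algebra.

Set Implicit Arguments.
Unset Strict Implicit.
Unset Printing Implicit Defensive.

(* A finite simple graph is a symmetric irreflexive relation [e] on a finType;
   the induced subgraph G[H] is represented by the vertex set [H]. *)

Definition graph_cycle (T : finType) (e : rel T) (p : seq T) : bool :=
  [&& 2 < size p, cycle e p & uniq p].

Definition cycle_through (T : finType) (e : rel T) (v : T) (n : nat) : bool :=
  [exists p : n.-tuple T, graph_cycle e p && (v \in (p : seq T))].

(* Vertices on a cycle are distinct, so lengths up to [#|T|] suffice. *)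
Definition longest_cycle (T : finType) (e : rel T) (v : T) : nat :=
  if [exists n : 'I_#|T|.+1, cycle_through e v n]
  then \max_(n < #|T|.+1 | cycle_through e v n) n
  else 2.

Definition hamiltonian (T : finType) (e : rel T) : Prop :=
  exists p : seq T, graph_cycle e p /\ (forall v : T, v \in p).

Definition clique (T : finType) (e : rel T) (A : {set T}) : bool :=
  [forall x in A, forall y in A, (x != y) ==> e x y].

(* In a simple graph, a subgraph isomorphic to K_s is determined by its vertex
   set, so N(G, K_s) counts the cliques of order s. *)
Definition num_complete (T : finType) (e : rel T) (s : nat) : nat :=
  #|[set A : {set T} | clique e A & #|A| == s]|.

(* Connectedness of G[A]; the null graph counts as connected. *)
Definition connected_in (T : finType) (e : rel T) (A : {set T}) : bool :=
  [forall x in A, forall y in A,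
     connect [rel a b | [&& a \in A, b \in A & e a b]] x y].

(* To be used for connected G[A] only. *)
Definition cut_vertex (T : finType) (e : rel T) (A : {set T}) (x : T) : bool :=
  (x \in A) && ~~ connected_in e (A :\ x).

Definition nonseparable (T : finType) (e : rel T) (A : {set T}) : bool :=
  [&& A != set0, connected_in e A & [forall x, ~~ cut_vertex e A x]].

(* [B] is the vertex set of a block of G[H]. Adding edges neither disconnects a
   graph nor creates cut-vertices, so a maximal connected subgraph without
   cut-vertices is induced. *)
Definition block (T : finType) (e : rel T) (H B : {set T}) : bool :=
  maxset (fun A => (A \subset H) && nonseparable e A) B.

Definition block_graph (T : finType) (e : rel T) (H : {set T}) : bool :=
  connected_in e H && [forall B : {set T}, block e H B ==> clique e B].

Definition block_adj (T : finType) (e : rel T) (H : {set T}) : rel {set T} :=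
  fun B C => [&& block e H B, block e H C, B != C & B :&: C != set0].

(* Length of a shortest [r]-path from [x] to [y] ([#|U|.+1] if there is none). *)
Definition distance (U : finType) (r : rel U) (x y : U) : nat :=
  find (fun n => [exists p : n.-tuple U, path r x p && (last x p == y)])
       (iota 0 #|U|.+1).

(* Three or more blocks sharing a vertex are pairwise adjacent, so the graph
   [block_adj] may contain triangles. However, once a root [R] is fixed, every
   other block [B] of a connected block graph has exactly one neighbour [P]
   closer to [R], and this is its parent in the rooted block tree. *)
Definition parent_block (T : finType) (e : rel T) (H R P B : {set T}) : bool :=
  block_adj e H P B &&
  (distance (block_adj e H) R B == (distance (block_adj e H) R P).+1).

(* The null graph has no block to root the tree at; it is by convention a
   (trivial) parent-dominated block graph. *)
Definition parent_dominated_block_graph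
    (T : finType) (e : rel T) (H : {set T}) : Prop :=
  block_graph e H /\
  (H = set0 \/
   exists R : {set T},
     [/\ block e H R,
         forall B : {set T}, block e H B -> #|B| <= #|R|
       & forall B P : {set T}, parent_block e H R P B -> #|B| <= #|P|]).

Local Open Scope ring_scope.

Definition clique_weight (s c : nat) : rat := 'C(c, s)%:R / (c%:R - 1).

Definition clique_bound (T : finType) (e : rel T) (s : nat) (u : T) : rat :=
  \sum_(v : T) clique_weight s (longest_cycle e v)
    - clique_weight s (longest_cycle e u).

(* Main.v *)
Require Import Defs.
From mathcomp Require Import all_boot all_order all_algebra.
From mathcomp Require Import perm zify ring lra.

Set Implicit Arguments.
Unset Strict Implicit.
Unset Printing Implicit Defensive.

Import Order.TTheory GRing.Theory Num.Theory.

(* For [s >= 2] the bound is proved by induction on the vertex set [A].  Among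
   the longest paths of G[A] choose one whose first vertex has a neighbour as
   far along the path as possible; let [S] be the initial segment up to that
   neighbour [z], put [t = |S|], and let [L] be the set of first vertices of
   Hamiltonian paths of G[S] ending at [z].  Neighbours of [L] lie in [S], by
   Posa rotation a vertex of [L] has degree at most [|L|], and [S] lies on a
   cycle of length [t].  Giving each s-clique [Q] that meets [L] the weight
   [1/|Q :&: L|] at each vertex of [Q :&: L], every vertex of [L] receives at
   most ['C(t, s) / (t - 1)], by convexity of ['C(x, s - 1)] in [x]; then delete
   [L].  If equality holds then, by induction, the rest is a block graph, which
   forces [S :\: L = [set z]] and [S] to be a clique glued at [z].  Hence G[H]
   is a connected block graph.

   For a connected block graph rooted at a largest block, let [top v] be the
   block containing [v] that is closest to the root.  All vertices of a block
   [B] except one (any one for the root) have top block [B], so the number of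
   s-cliques is the sum of the weights of [|top v|] over all vertices but one.
   Comparing with [c v], the largest order of a block containing [v], equality
   holds iff [top v] is always a largest block containing [v], that is, iff no
   block is larger than its parent. *)

(** * Binomial weights *)

(** By Pascal's rule the one-step increment of ['C(x, k.+1)] is ['C(x, k)], which is monotone in
    [x]. *)
Lemma bin_convex k a b i : a <= b -> 'C(a + i, k) + 'C(b, k) <= 'C(a, k) + 'C(b + i, k).
Proof.
case: k => [|k] ab; first by rewrite !bin0.
elim: i => [|i IH]; first by rewrite !addn0.
rewrite !addnS !binS.
have := leq_bin2l k (leq_add ab (leqnn i)).
by lia.
Qed.

Lemma sum_bin_nat k a d : a <= d -> \sum_(a <= x < d) 'C(x, k) + 'C(a, k.+1) = 'C(d, k.+1).
Proof.
move/subnK => <-; elim: (d - a) => [|n IH]; first by rewrite big_geq.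
by rewrite addSn big_nat_recr /= ?leq_addl // binS -IH; lia.
Qed.

(** Pair [x] with its mirror image [a + d - x]: by convexity no pair exceeds the pair of end
    points. *)
Lemma sum_bin_trapezoid k a d : a <= d ->
  2 * \sum_(a <= x < d.+1) 'C(x, k) <= (d.+1 - a) * ('C(a, k) + 'C(d, k)).
Proof.
move=> ad; rewrite mul2n -addnn {2}big_nat_rev -big_split /= -sum_nat_const_nat.
rewrite big_nat_cond [leqRHS]big_nat_cond; apply: leq_sum => x; rewrite andbT => /andP[ax xd].
have -> : a + d.+1 - x.+1 = a + (d - x) by lia.
have h1 := @bin_convex k a x (d - x) ax.
by rewrite subnKC // in h1; rewrite addnC.
Qed.

(* Widening an interval centred at t/2 increases the average of the convex
   function 'C(x, k) over it. *)
Lemma sum_bin_centred k t a : 0 < a -> a.*2 <= t ->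
  t.-1 * \sum_(a <= x < (t - a).+1) 'C(x, k) <= (t - a.*2).+1 * \sum_(1 <= x < t) 'C(x, k).
Proof.
elim: a => // -[|a] IH _ at_.
  by rewrite (_ : (t - 1).+1 = t) 1?(_ : (t - 1.*2).+1 = t.-1) //; lia.
have {IH} := IH isT ltac:(lia).
have := @sum_bin_trapezoid k a.+1 (t - a.+1) ltac:(lia).
rewrite (_ : (t - a.+1).+1 - a.+1 = (t - a.+2.*2).+3); last by lia.
rewrite (_ : (t - a.+1.*2).+1 = (t - a.+2.*2).+3); last by lia.
rewrite (_ : (t - a.+2).+1 = t - a.+1); last by lia.
rewrite big_ltn; last by lia.
rewrite big_nat_recr /=; last by lia.
set X := \sum_(_ <= x < t - _) _; set C := \sum_(_ <= x < t) _.
set n := t - _.*2; set g := 'C(_, _); set h := 'C(_, _); set M := t.-1.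
move=> h1 h2.
(* [X] sums the [n.+1] inner terms; [g] and [h] are the two end terms dropped in this step. In [n.+3
   * M * X = n.+1 * M * X + M * (2 * X)], [h3] bounds the last summand by [n.+1 * M * (g + h)], and
   the induction hypothesis [h2] bounds the total. *)
have h3 : 2 * X <= n.+1 * (g + h) by lia.
suff : n.+3 * (M * X) <= n.+3 * (n.+1 * C) by rewrite leq_pmul2l.
have h4 := leq_mul (leqnn n.+1) h2.
have h5 := leq_mul (leqnn M) h3.
by lia.
Qed.


Lemma eq_sum_le (I : finType) (P : pred I) (F G : I -> rat) :
  (forall i, P i -> F i <= G i)%R -> (\sum_(i | P i) F i = \sum_(i | P i) G i)%R ->
  forall i, P i -> F i = G i.
Proof.
move=> FG eqFG i Pi; apply/esym/eqP; rewrite -subr_eq0; apply/eqP.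
apply: (psumr_eq0P (P := P) (F := fun i => G i - F i)%R) => // [j /FG|].
  by rewrite subr_ge0.
by rewrite sumrB eqFG subrr.
Qed.

(** * Monotonicity of the clique weights *)

Section CliqueWeight.
Local Open Scope ring_scope.
Variable s : nat.
Hypothesis s_ge2 : (2 <= s)%N.

Lemma clique_weight_small c : (c < s)%N -> clique_weight s c = 0.
Proof. by move=> cs; rewrite /clique_weight bin_small // mul0r. Qed.

Lemma natr_subr1 c : (0 < c)%N -> (c%:R - 1 : rat) = c.-1%:R.
Proof. by case: c => // c _; rewrite -[c.+1]addn1 natrD addrK addn1. Qed.

Lemma clique_weightE c : (2 <= c)%N -> clique_weight s c * c.-1%:R = 'C(c, s)%:R.
Proof.
move=> c2; rewrite /clique_weight natr_subr1; last by lia.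
by rewrite mulfVK // pnatr_eq0; lia.
Qed.

Lemma clique_weight_ge0 c : (2 <= c)%N -> 0 <= clique_weight s c.
Proof.
by move=> c2; rewrite /clique_weight natr_subr1 ?divr_ge0 ?ler0n //; lia.
Qed.

Lemma clique_weight_gt0 c : (s <= c)%N -> 0 < clique_weight s c.
Proof.
move=> sc; rewrite /clique_weight natr_subr1; last by lia.
by rewrite divr_gt0 ?ltr0n ?bin_gt0 //; lia.
Qed.

(** If [s <= c.+1], cross-multiplying reduces strictness to [c * 'C(c, s) < c.-1 * 'C(c.+1, s)],
    which follows from Pascal's rule and the ratio of ['C(c, s)] to ['C(c, s.-1)]. Otherwise both
    weights vanish. *)
Lemma clique_weightS c : (2 <= c)%N ->
  clique_weight s c <= clique_weight s c.+1 ?= iff (c.+1 < s)%N.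
Proof.
move=> c2; have [cs|cs] := ltnP c.+1 s.
  by rewrite !clique_weight_small ?(ltnW cs) //; exact: leif_refl.
have h : (c * 'C(c, s) < c.-1 * 'C(c.+1, s))%N.
  case: s s_ge2 cs => // r r2 cs; rewrite binS.
  have p : (0 < 'C(c, r))%N by rewrite bin_gt0.
  have e := mul_bin_left c r; nia.
have lt : clique_weight s c < clique_weight s c.+1.
  rewrite -(@ltr_pM2r _ (c%:R * c.-1%:R)); last by rewrite mulr_gt0 ?ltr0n //; lia.
  have -> : clique_weight s c * (c%:R * c.-1%:R) = c%:R * 'C(c, s)%:R.
    by rewrite -clique_weightE //; ring.
  have -> : clique_weight s c.+1 * (c%:R * c.-1%:R) = c.-1%:R * 'C(c.+1, s)%:R.
    by rewrite -(@clique_weightE c.+1) 1?ltnW //=; ring.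
  by rewrite -!natrM ltr_nat.
by split; [exact: ltW|rewrite (lt_eqF lt)].
Qed.

Lemma clique_weight_le c d : (2 <= c)%N -> (c <= d)%N -> clique_weight s c <= clique_weight s d.
Proof.
move=> c2 /subnK <-; elim: (d - c)%N => [|n IH] //.
by apply: (le_trans IH); rewrite addSn clique_weightS //; lia.
Qed.

Lemma clique_weight_lt c d : (2 <= c)%N -> (c < d)%N -> (s <= d)%N ->
  clique_weight s c < clique_weight s d.
Proof.
move=> c2; case: d => // d cd sd; apply: (le_lt_trans (@clique_weight_le c d c2 cd)).
by rewrite (lt_leif (clique_weightS _)); lia.
Qed.

Lemma clique_weight_le_inv c d : (2 <= d)%N -> (s <= c)%N ->
  clique_weight s c <= clique_weight s d -> (c <= d)%N.
Proof.
move=> d2 sc le; rewrite leqNgt; apply/negP => dc.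
by have := clique_weight_lt d2 dc sc; rewrite ltNge le.
Qed.

(* The average of ['C(x, s - 1)] over [a <= x <= d]. *)
Definition degree_weight (a d : nat) : rat :=
  ('C(d.+1, s)%:R - 'C(a, s)%:R) / (d.+1 - a)%:R.

(** Widening [[a, d]] about its centre to [[1, a + d - 1]] does not decrease the average, and by the
    hockey-stick identity the new average is the weight of [a + d]. *)
Lemma degree_weight_le_centred a d : (a <= d)%N -> (0 < a)%N ->
  degree_weight a d <= clique_weight s (a + d).
Proof.
move=> ad a0; rewrite /degree_weight.
have h := @sum_bin_centred s.-1 (a + d) a a0 ltac:(lia).
have e1 := @sum_bin_nat s.-1 a d.+1 ltac:(lia).
have e2 := @sum_bin_nat s.-1 1 (a + d) ltac:(lia).
rewrite !prednK in e1 e2; [|lia..].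
rewrite [in 'C(1, s)]bin_small // addn0 in e2.
rewrite e2 addKn in h.
rewrite -e1 natrD addrK ler_pdivrMr; last by rewrite ltr0n; lia.
rewrite -(@ler_pM2r _ (a + d).-1%:R); last by rewrite ltr0n; lia.
rewrite mulrAC clique_weightE; last by lia.
rewrite -!natrM ler_nat mulnC (leq_trans h) // mulnC.
by apply: eq_leq; congr (_ * _)%N; lia.
Qed.

Lemma degree_weight_le_lt a d t : (a <= d)%N -> (0 < d)%N -> (d < t)%N -> (a + d <= t)%N ->
  degree_weight a d <= clique_weight s t /\
  ((a + d < t)%N -> (s <= t)%N -> degree_weight a d < clique_weight s t).
Proof.
(* Widening requires a positive left end. For [a = 0] the average is ['C(d.+1, s) / d.+1], compared
   directly with the weight of [d.+1 <= t], whose denominator is [d]. *)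
move=> ad d0 dt adt; case: a ad adt => [|a] ad adt.
  rewrite /degree_weight [in 'C(0, s)]bin_small ?subr0 ?subn0; last by lia.
  have le1 : 'C(d.+1, s)%:R / d.+1%:R <= clique_weight s d.+1.
    rewrite ler_pdivrMr ?ltr0n // -clique_weightE; last by lia.
    by rewrite ler_wpM2l ?clique_weight_ge0 ?ler_nat //; lia.
  split=> [|_ st]; first by apply: (le_trans le1); apply: clique_weight_le; lia.
  have [sd|sd] := ltnP d.+1 s.
    by rewrite bin_small // mul0r clique_weight_gt0.
  apply: (@lt_le_trans _ _ (clique_weight s d.+1)); last by apply: clique_weight_le; lia.
  rewrite ltr_pdivrMr ?ltr0n // -clique_weightE; last by lia.
  by rewrite ltr_pM2l ?clique_weight_gt0 // ltr_nat.
have le1 := degree_weight_le_centred ad isT.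
split=> [|lt st]; first by apply: (le_trans le1); apply: clique_weight_le; lia.
by apply: (le_lt_trans le1); apply: clique_weight_lt; lia.
Qed.

End CliqueWeight.

(** * Sharing each set equally among its marked vertices *)

Section DoubleCount.
Local Open Scope ring_scope.
Variable T : finType.

Lemma card_draws_disjoint (B M : {set T}) s : M \subset B ->
  (#|[set Q : {set T} | (Q \subset B) && (#|Q| == s) && ~~ [disjoint Q & M]]| + 'C(#|B| - #|M|, s)
   = 'C(#|B|, s))%N.
Proof.
move=> MB; rewrite -(cards_draws B) -(cardsDS MB) -(cards_draws (B :\: M)).
rewrite -[RHS](cardsID [set Q : {set T} | [disjoint Q & M]]) addnC; congr (_ + _)%N.
  by apply: eq_card => Q; rewrite !inE subsetD -!andbA; case: (Q \subset B) => //=; rewrite andbC.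
by apply: eq_card => Q; rewrite !inE andbC.
Qed.

(** Each [Q] meeting [M] distributes one unit equally over the vertices of [Q :&: M]. *)
Lemma card_meeting (P : pred {set T}) (M : {set T}) :
  #|[set Q : {set T} | P Q && ~~ [disjoint Q & M]]|%:R
  = \sum_(z in M) \sum_(Q : {set T} | (z \in Q) && P Q) (#|Q :&: M|%:R^-1 : rat).
Proof.
rewrite (exchange_big_dep P) /=; last by move=> z Q _ /andP[].
rewrite -sum1_card natr_sum big_mkcond [RHS]big_mkcond /=; apply: eq_bigr => Q _.
rewrite inE; case PQ: (P Q) => //=.
rewrite (eq_bigl [in Q :&: M]); last by move=> z; rewrite inE andbT andbC.
rewrite sumr_const -setI_eq0 -cards_eq0.
by case: (#|_|) => [|n] /=; rewrite ?mulr0n // -(mulr_natr _^-1) mulVf // pnatr_eq0.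
Qed.

Lemma sum_inv_card_draws (B M : {set T}) (y : T) s : M \subset B -> y \in M ->
  \sum_(Q : {set T} | [&& y \in Q, Q \subset B & #|Q| == s]) (#|Q :&: M|%:R^-1 : rat)
  = ('C(#|B|, s)%:R - 'C(#|B| - #|M|, s)%:R) / #|M|%:R.
Proof.
move=> MB yM; rewrite -(@card_draws_disjoint B M s MB) natrD addrK.
have M0 : (#|M|%:R : rat) != 0 by rewrite pnatr_eq0 -lt0n; apply/card_gt0P; exists y.
apply: (mulIf M0); rewrite mulfVK //.
(* By symmetry under transpositions the inner sum does not depend on [y]. *)
transitivity (\sum_(z in M) \sum_(Q : {set T} | [&& z \in Q, Q \subset B & #|Q| == s])
                (#|Q :&: M|%:R^-1 : rat)).
  rewrite mulr_natr -sumr_const; apply: eq_bigr => z zM.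
  have inj : injective (fun Q : {set T} => tperm y z @: Q) by exact/imset_inj/perm_inj.
  have im (X Q : {set T}) : y \in X -> z \in X -> (tperm y z @: Q \subset X) = (Q \subset X).
    move=> yX zX; apply/subsetP/subsetP => sub x xQ.
      have := sub _ (imset_f (tperm y z) xQ).
      by case: tpermP => [-> _|-> _|].
    by case/imsetP: xQ => w wQ ->; case: tpermP => [_|_|_ _] //; exact: sub.
  have imI (Q : {set T}) : tperm y z @: Q :&: M = tperm y z @: (Q :&: M).
    rewrite imsetI; last by move=> ? ? _ _; exact: perm_inj.
    congr (_ :&: _); apply/esym/eqP; rewrite eqEcard card_imset ?leqnn ?andbT; last exact: perm_inj.
    by rewrite im.
  rewrite (reindex_inj inj) /=; apply: eq_big => Q.
    rewrite im ?(subsetP MB) // card_imset; last exact: perm_inj.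
    by rewrite -[in RHS](mem_imset _ _ (@perm_inj _ (tperm y z))) tpermR.
  by move=> _; rewrite imI card_imset //; exact: perm_inj.
by rewrite -card_meeting.
Qed.

End DoubleCount.

(** * Longest cycles and ends of longest paths *)

(** Keeping the vertex type lets [longest_cycle] apply to G[A] directly; vertices outside [A] become
    isolated. *)
Definition induced (T : finType) (e : rel T) (A : {set T}) : rel T :=
  [rel x y | [&& x \in A, y \in A & e x y]].

Section LongestCycle.
Variables (T : finType) (e : rel T).
Implicit Types (v : T) (p : seq T) (A : {set T}).

Lemma graph_cycle_size p : graph_cycle e p -> size p <= #|T|.
Proof. by case/and3P=> _ _ up; rewrite -(card_uniqP up) max_card. Qed.

Lemma longest_cycle_max v p : graph_cycle e p -> v \in p -> size p <= longest_cycle e v.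
Proof.
move=> cp vp; have lt : size p < #|T|.+1 by rewrite ltnS graph_cycle_size.
have ct : cycle_through e v (Ordinal lt) by apply/existsP; exists (in_tuple p); rewrite cp.
rewrite /longest_cycle ifT; last by apply/existsP; exists (Ordinal lt).
exact: (@leq_bigmax_cond _ _ (fun n : 'I__ => n : nat) (Ordinal lt)).
Qed.

Lemma longest_cycleP v : longest_cycle e v = 2 \/
  exists p, [/\ graph_cycle e p, v \in p & size p = longest_cycle e v].
Proof.
rewrite /longest_cycle; case: existsP => [ex|_]; [right|by left].
have [|n ct ->] := @eq_bigmax_cond _ [pred n : 'I_#|T|.+1 | cycle_through e v n] (fun n => n : nat).
  by case: ex => n ct; apply/card_gt0P; exists n.
case/existsP: ct => p /andP[cp vp]; exists p; split=> //; exact: size_tuple.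
Qed.

Lemma longest_cycle_ge2 v : 2 <= longest_cycle e v.
Proof. by case: (longest_cycleP v) => [->|[p [/andP[/ltnW p2 _] _ <-]]]. Qed.

Lemma longest_cycle_witness v : 2 < longest_cycle e v ->
  exists p, [/\ graph_cycle e p, v \in p & size p = longest_cycle e v].
Proof. by case: (longest_cycleP v) => [->|]. Qed.

Lemma longest_cycle_le_card v : 2 <= #|T| -> longest_cycle e v <= #|T|.
Proof. by case: (longest_cycleP v) => [->|[p [cp _ <-]]] // _; exact: graph_cycle_size. Qed.

Lemma graph_cycle_induced A p :
  graph_cycle (induced e A) p = graph_cycle e p && all [in A] p.
Proof.
have [pA|pA] := boolP (all [in A] p).
  rewrite andbT; congr [&& _, _ & _].
  apply: (@eq_in_cycle _ [in A]) => // x y xA yA.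
  by rewrite /induced /= [x \in A]xA [y \in A]yA.
rewrite andbF; apply/negbTE/negP => /and3P[_ cp _].
case/negP: pA; apply/allP => x xp.
by have /and3P[] := next_cycle cp xp.
Qed.

End LongestCycle.

Section Circumference.
Variables (T : finType) (e : rel T).
Implicit Types (v : T) (p : seq T) (A B : {set T}).

Definition circ A v := longest_cycle (induced e A) v.

Lemma circ_ge2 A v : 2 <= circ A v.
Proof. exact: longest_cycle_ge2. Qed.

Lemma circ_max A v p : graph_cycle e p -> {subset p <= A} -> v \in p -> size p <= circ A v.
Proof.
move=> cp pA vp; apply: longest_cycle_max => //.
by rewrite graph_cycle_induced cp; apply/allP.
Qed.

Lemma circ_witness A v : 2 < circ A v ->
  exists p, [/\ graph_cycle e p, {subset p <= A}, v \in p & size p = circ A v].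
Proof.
case/longest_cycle_witness=> p []; rewrite graph_cycle_induced => /andP[cp /allP pA] vp sp.
by exists p.
Qed.

Lemma circ_le A B v : A \subset B -> circ A v <= circ B v.
Proof.
move=> /subsetP AB; have := circ_ge2 A v; rewrite leq_eqVlt => /predU1P[<-|]; first exact: circ_ge2.
case/circ_witness=> p [cp pA vp <-]; apply: circ_max => // x /pA; exact: AB.
Qed.

End Circumference.

(** * First vertices of longest paths *)

Section PathEnd.
Variables (T : finType) (e : rel T).
Hypotheses (e_sym : symmetric e) (e_irr : irreflexive e).
Implicit Types (A S : {set T}) (x y z w : T) (p q r : seq T).

Definition gpath A q := [&& sorted e q, uniq q & all [in A] q].

Lemma gpath_cons A w y q :
  gpath A [:: w, y & q] = [&& e w y, w \in A, w \notin y :: q & gpath A (y :: q)].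
Proof.
rewrite /gpath /=; case: (e w y) => //=; case: (w \in A) => /=; last by rewrite !andbF.
by case: (w \notin _); rewrite ?andbF.
Qed.

(** The vertices after [y] form a tuple of the forced length [|S| - 1], so that the existential
    ranges over a finite type. *)
Definition ham_ends S z : {set T} :=
  [set y | [exists r : #|S|.-1.-tuple T,
     [&& path e y r, uniq (y :: r), [set x in y :: r] == S & last y r == z]]].

Lemma ham_endsP S z y : reflect
  (exists r, [/\ path e y r, uniq (y :: r), y :: r =i S & last y r = z])
  (y \in ham_ends S z).
Proof.
rewrite inE; apply: (iffP existsP) => [[r /and4P[pr ur /eqP rS /eqP lr]]|[r [pr ur rS lr]]].
  by exists r; split=> // x; move/setP/(_ x): rS => <-; rewrite inE.
have sr : size r = #|S|.-1 by rewrite -(eq_card rS) (card_uniqP ur).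
exists (tcast sr (in_tuple r)); rewrite val_tcast /= pr lr eqxx andbT.
by move: ur => /= ->; apply/eqP/setP => x; rewrite inE rS.
Qed.

(** A second vertex is needed: for [S = [set z]] the vertex [z] is itself an end. *)
Lemma ham_ends_sub S z : 1 < #|S| -> ham_ends S z \subset S :\ z.
Proof.
move=> S2; apply/subsetP => y /ham_endsP[r [_ /andP[yr _] rS lr]].
rewrite !inE -rS mem_head andbT -lr.
case: r yr rS {lr} => [|x r] yr rS; last by apply: contraNneq yr => /= ->; exact: mem_last.
by move: S2; rewrite -(eq_card rS) ltnNge (leq_trans (card_size _)).
Qed.

(* If [w] follows [w'] on a path from [y] and [y] is adjacent to [w], reversing
   the part up to [w'] gives a path from [w'] with the same last vertex. *)
Lemma ham_ends_degree S z y : y \in ham_ends S z ->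
  #|[set w in S | e y w]| <= #|ham_ends S z|.
Proof.
case/ham_endsP=> r [pr ur rS lr].
(* Prepending [y] shifts positions by one, so [f w] is the predecessor of [w] on the path
   [y :: r]. *)
pose f w := nth y (y :: r) (index w r).
have Nr w : w \in S -> e y w -> w \in r.
  by rewrite -rS inE => /predU1P[->|//]; rewrite e_irr.
have f_inj : {in [set w in S | e y w] &, injective f}.
  move=> w w'; rewrite !inE => /andP[wS yw] /andP[wS' yw'] /eqP.
  have [wr wr'] := (Nr _ wS yw, Nr _ wS' yw').
  rewrite nth_uniq //= ?ltnS 1?ltnW ?index_mem // => /eqP ii.
  by rewrite -(nth_index y wr) ii nth_index.
rewrite -(card_in_imset f_inj); apply/subset_leq_card/subsetP => _ /imsetP[w + ->].
rewrite inE => /andP[wS yw]; have wr := Nr _ wS yw.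
case/splitPr: wr pr ur rS lr @f {Nr f_inj} => p1 p2 pr ur rS lr f.
have -> : f w = last y p1.
  move: ur => /= /andP[_]; rewrite cat_uniq => /and3P[_ /hasPn/(_ w (mem_head _ _)) wp1 _].
  by rewrite /f index_cat (negbTE wp1) /= eqxx addn0 (last_nth y) -cat_cons nth_cat /= ltnS leqnn.
move: pr; rewrite cat_path /= => /and3P[p1p _ p2p].
apply/ham_endsP; exists (rev (belast y p1) ++ w :: p2).
have perm : perm_eq (last y p1 :: rev (belast y p1) ++ w :: p2) (y :: p1 ++ w :: p2).
  by rewrite -cat_cons -rev_rcons -lastI -(cat_cons y) perm_cat2r perm_rev.
split.
- rewrite cat_path rev_path /= p2p andbT (eq_path (e' := e)) ?p1p; last by move=> a b; rewrite /= e_sym.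
  case: p1 {ur rS lr f p1p perm} => [|x p1] //=; by rewrite rev_cons last_rcons.
- by rewrite (perm_uniq perm).
- by move=> x; rewrite (perm_mem perm) rS.
- by rewrite last_cat /= -lr last_cat.
Qed.

(* A longest path of G[A], split at the last neighbour [z] of its first vertex;
   [D] is what follows [z], and the first part, a Hamiltonian path of G[S], is
   only recorded through the set [ham_ends S z] of possible first vertices. *)
Record path_end A S z (D : seq T) : Prop := PathEnd {
  pe_sub : S \subset A;
  pe_card : 1 < #|S|;
  pe_ends : ham_ends S z != set0;
  pe_nbrs : forall y w, y \in ham_ends S z -> w \in A -> e y w -> w \in S;
  pe_circ : forall v, v \in S -> #|S| <= circ e A v;
  pe_tail : [/\ path e z D, uniq D, {subset D <= A} & {in D, forall x, x \notin S}];
  pe_longest : forall q, gpath A q -> size q <= #|S| + size D }.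

(** First the order [m] of a path is maximised, then the position [t] of a neighbour of its first
    vertex. Replacing the initial segment by another Hamiltonian path of G[S] ending at the same
    vertex gives another longest path. Hence a neighbour of an end outside [S] would either prolong
    that path or, lying on the tail, contradict the choice of [t]. *)
Lemma path_end_exists A x y : x \in A -> y \in A -> e x y ->
  exists S z D, path_end A S z D.
Proof.
move=> xA yA xy.
have xNy : x != y by apply: contraTneq xy => ->; rewrite e_irr.
pose P m := [exists q : m.-tuple T, gpath A q].
have P2 : P 2.
  by apply/existsP; exists [tuple x; y]; rewrite /gpath /= xy inE xNy xA yA.
have Pb m : P m -> m <= #|T|.
  case/existsP=> q /and3P[_ uq _]; rewrite -(size_tuple q) -(card_uniqP uq); exact: max_card.
have exP : exists m, P m by exists 2.
case: (ex_maxnP exP Pb) => m /existsP[q0 gq0] m_max.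
have longest q : gpath A q -> size q <= m.
  by move=> gq; apply: m_max; apply/existsP; exists (in_tuple q).
have m2 : 1 < m by apply: (longest [:: x; y]); rewrite /gpath /= xy inE xNy xA yA.
pose Q t := (t < m) && [exists q : m.-tuple T, gpath A q && e (head x q) (nth x q t)].
have Q1 : Q 1.
  rewrite /Q m2; apply/existsP; exists q0; rewrite gq0 /=.
  have : 1 < size q0 by rewrite size_tuple.
  by case: (tval q0) gq0 => [|a [|b q]] //= /andP[/andP[-> _] _].
have Qb t : Q t -> t <= m by case/andP=> /ltnW.
have exQ : exists t, Q t by exists 1.
case: (ex_maxnP exQ Qb) => t /andP[tm /existsP[q /andP[gq qt]]] t_max.
have t0 : 0 < t by exact: t_max.
case: q qt gq => -[|a q] /= sq; first by rewrite -(eqP sq) in m2.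
case: t t0 tm t_max => // t _ tm t_max /= qt gq.
move/eqP: sq => /= sq.
have tq : t < size q by rewrite -ltnS sq.
pose r := take t.+1 q; pose D := drop t.+1 q.
have qE : q = r ++ D by rewrite cat_take_drop.
have sr : size r = t.+1 by rewrite size_takel.
have nt : nth x q t = last a r.
  by rewrite (set_nth_default a) // (last_nth a) sr /= nth_take.
have /and3P[] := gq; rewrite /= qE cat_path mem_cat cat_uniq all_cat negb_or -!andbA.
move=> /andP[pr pD] /and5P[anr anD ur rD uD] /and3P[aA rA DA].
pose S := [set v in a :: r].
have uar : uniq (a :: r) by rewrite /= anr.
have cS : #|S| = t.+2 by rewrite cardsE (card_uniqP uar) /= sr.
have endq y' r' : path e y' r' -> uniq (y' :: r') -> y' :: r' =i S -> last y' r' = last a r ->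
    gpath A (y' :: r' ++ D) /\ size (y' :: r' ++ D) = m.
  move=> pr' ur' rS lr'; have mem' : y' :: r' =i a :: r by move=> w; rewrite rS inE.
  split; last first.
    rewrite -sq qE /= !size_cat; congr (_ + _).+1.
    by move/eq_card: mem'; rewrite (card_uniqP ur') (card_uniqP uar) => -[].
  rewrite /gpath [sorted _ _]/= cat_path pr' lr' pD -(cat_cons y' r' D) cat_uniq ur' uD.
  rewrite all_cat DA (eq_all_r mem') [all _ (a :: r)]/= aA rA !andbT /=.
  apply/hasPn => w wD; rewrite mem' inE negb_or (hasPn rD) // andbT.
  by apply: contraNneq anD => <-.
exists S, (last a r), D; split.
- by apply/subsetP => w; rewrite inE => /predU1P[->//|/(allP rA)].
- by rewrite cS.
- apply/set0Pn; exists a; apply/ham_endsP; exists r; split=> //.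
  by move=> w; rewrite [RHS]inE.
- move=> y' w /ham_endsP[r' [pr' ur' rS lr']] wA y'w.
  have [gq' sq'] := endq _ _ pr' ur' rS lr'.
  rewrite -rS; apply: contraTT isT => wr.
  have [wD|wD] := boolP (w \in D); last first.
    have : gpath A (w :: y' :: r' ++ D).
      by rewrite gpath_cons e_sym y'w wA gq' -cat_cons mem_cat negb_or wr wD.
    by move/longest; rewrite /= -[X in _ <= X]sq' ltnn.
  have sq'E : size (y' :: r' ++ D) == m by rewrite sq'.
  have im : index w (y' :: r' ++ D) < m.
    by rewrite -sq' index_mem -cat_cons mem_cat wD orbT.
  have : index w (y' :: r' ++ D) <= t.+1.
    apply: t_max; rewrite /Q im; apply/existsP; exists (Tuple sq'E).
    by rewrite gq' nth_index //= -cat_cons mem_cat wD orbT.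
  rewrite -cat_cons index_cat (negbTE wr) leqNgt => /negP[].
  by rewrite -(card_uniqP ur') (eq_card rS) cS ltnS leq_addr.
- move=> v; rewrite inE => va; rewrite cS.
  (* For [t = 0] the segment is a single edge, and [|S| = 2] is covered by the default value of
     [circ]. *)
  have [->|t_gt0] := posnP t; first exact: circ_ge2.
  apply: leq_trans (@circ_max _ e A v (a :: r) _ _ va); first by rewrite /= sr.
    by rewrite /graph_cycle uar andbT /= sr !ltnS t_gt0 rcons_path pr -nt e_sym.
  by move=> w; rewrite inE => /predU1P[->//|/(allP rA)].
- split=> //; first exact/allP.
  move=> w wD; rewrite inE inE negb_or (hasPn rD) // andbT.
  by apply: contraNneq anD => <-.
- by move=> q' /longest; rewrite cS -sq qE size_cat sr.
Qed.

End PathEnd.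

(** * Nonseparable sets and block graphs *)

Section Nonseparable.
Variables (T : finType) (e : rel T).
Hypotheses (e_sym : symmetric e) (e_irr : irreflexive e).
Implicit Types (v x y z : T) (p q : seq T) (A B C X Y : {set T}).

Lemma setD1_notin A x : x \notin A -> A :\ x = A.
Proof. by move=> xA; apply/setDidPl; rewrite disjoint_sym disjoints1. Qed.

Lemma cliqueP A : reflect {in A &, forall x y, x != y -> e x y} (clique e A).
Proof.
apply: (iffP forall_inP) => [cA x y xA yA xy|cA x xA].
  by have /forall_inP/(_ y yA)/implyP/(_ xy) := cA x xA.
by apply/forall_inP => y yA; apply/implyP; exact: cA.
Qed.

Lemma clique_sub A B : A \subset B -> clique e B -> clique e A.
Proof. by move=> /subsetP AB /cliqueP cB; apply/cliqueP => x y /AB xB /AB; exact: cB. Qed.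

Lemma clique_path C x q : clique e C -> {subset x :: q <= C} -> uniq (x :: q) -> path e x q.
Proof.
move=> /cliqueP cC; elim: q x => //= y q IH x sub /andP[xN uq].
rewrite IH ?andbT //; last by move=> w wq; apply: sub; rewrite inE wq orbT.
apply: cC; rewrite ?sub ?inE ?eqxx ?orbT //.
by apply: contraNneq xN => ->; rewrite mem_head.
Qed.

Lemma clique_ham C x w : clique e C -> x \in C -> w \in C -> x != w ->
  exists q, [/\ path e x (rcons q w), uniq (x :: rcons q w) & x :: rcons q w =i C].
Proof.
move=> cC xC wC xw; exists (enum (C :\ x :\ w)).
have mem : x :: rcons (enum (C :\ x :\ w)) w =i C.
  move=> v; rewrite inE mem_rcons inE mem_enum !inE.
  have [->|vx] := eqVneq v x; first by rewrite xC.
  by have [->|] := eqVneq v w; rewrite ?wC.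
have uq : uniq (x :: rcons (enum (C :\ x :\ w)) w).
  by rewrite /= rcons_uniq enum_uniq mem_rcons inE negb_or xw !mem_enum !inE !eqxx ?andbF.
by split=> //; apply: (clique_path cC) => // v; rewrite mem.
Qed.

Lemma clique_graph_cycle C : clique e C -> 2 < #|C| ->
  exists p, [/\ graph_cycle e p, p =i C & size p = #|C|].
Proof.
move=> cC C3; have [x [w [xC wC xw]]] : exists x w, [/\ x \in C, w \in C & x != w].
  by apply/card_gt1P; exact: ltnW.
have [q [pq uq qC]] := clique_ham cC xC wC xw.
have sq : size (x :: rcons q w) = #|C| by rewrite -(card_uniqP uq) (eq_card qC).
exists (x :: rcons q w); split=> //; apply/and3P; split=> //; first by rewrite sq.
rewrite /= rcons_path pq last_rcons; apply: (cliqueP _ cC) => //.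
by rewrite eq_sym.
Qed.

Lemma connected_inP A :
  reflect {in A &, forall x y, connect (induced e A) x y} (connected_in e A).
Proof.
apply: (iffP forall_inP) => [cA x y xA yA|cA x xA].
  by have /forall_inP/(_ y yA) := cA x xA.
by apply/forall_inP => y yA; exact: cA.
Qed.

Lemma induced_sym A : symmetric (induced e A).
Proof. by move=> x y; rewrite /induced /= e_sym; case: (x \in A); rewrite ?andbF. Qed.

Lemma connect_induced_sym A : connect_sym (induced e A).
Proof. exact/sym_connect_sym/induced_sym. Qed.

Lemma connect_induced_sub A B : A \subset B ->
  subrel (connect (induced e A)) (connect (induced e B)).
Proof.
move=> /subsetP AB; apply: connect_sub => x y /and3P[xA yA xy].
by apply: connect1; rewrite /induced /= !AB.
Qed.

Lemma connected_in_clique A : clique e A -> connected_in e A.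
Proof.
move=> /cliqueP cA; apply/connected_inP => x y xA yA.
have [->|xy] := eqVneq x y; first exact: connect0.
by apply: connect1; rewrite /induced /= xA yA cA.
Qed.

Lemma connected_inU A B : connected_in e A -> connected_in e B -> A :&: B != set0 ->
  connected_in e (A :|: B).
Proof.
move=> /connected_inP cA /connected_inP cB /set0Pn[z /setIP[zA zB]].
have to_z x : x \in A :|: B -> connect (induced e (A :|: B)) x z.
  case/setUP=> xX.
    by apply: (connect_induced_sub (subsetUl A B)); exact: cA.
  by apply: (connect_induced_sub (subsetUr A B)); exact: cB.
apply/connected_inP => x y /to_z xz /to_z yz.
by apply: connect_trans xz _; rewrite connect_induced_sym.
Qed.

Lemma nonseparableP A : reflect
  [/\ A != set0, connected_in e A & forall x, connected_in e (A :\ x)] (nonseparable e A).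
Proof.
apply: (iffP and3P) => -[A0 cA h]; split=> //.
  move=> x; have /forallP/(_ x) := h; rewrite /cut_vertex negb_and negbK => /orP[xA|//].
  by rewrite setD1_notin.
by apply/forallP => x; rewrite /cut_vertex h andbF.
Qed.

Lemma nonseparable_clique A : A != set0 -> clique e A -> nonseparable e A.
Proof.
move=> A0 cA; apply/nonseparableP; split=> //; first exact: connected_in_clique.
by move=> x; apply/connected_in_clique/(clique_sub _ cA); exact: subD1set.
Qed.

(** Of two common vertices at least one survives the deletion of [x], so the remainders still
    overlap. *)
Lemma nonseparableU A B : nonseparable e A -> nonseparable e B -> 1 < #|A :&: B| ->
  nonseparable e (A :|: B).
Proof.
move=> /nonseparableP[A0 cA hA] /nonseparableP[B0 cB hB] AB.
apply/nonseparableP; split.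
- by case/set0Pn: A0 => x xA; apply/set0Pn; exists x; rewrite inE xA.
- by apply: connected_inU => //; rewrite -card_gt0 ltnW.
move=> x; rewrite setDUl; apply: connected_inU => //.
rewrite -setDIl -card_gt0.
by have := cardsD1 x (A :&: B); case: (x \in _) => /=; lia.
Qed.

Lemma connected_in_path x p : path e x p -> connected_in e [set y in x :: p].
Proof.
elim: p x => [|y p IH] x /=.
  by move=> _; apply/connected_in_clique/cliqueP => a b; rewrite !inE => /eqP-> /eqP->; rewrite eqxx.
case/andP=> xy /IH cp.
have -> : [set w in [:: x, y & p]] = [set x; y] :|: [set w in y :: p].
  by apply/setP => w; rewrite !inE -!orbA; case: (w == y); rewrite ?orbT.
apply: connected_inU => //; last by apply/set0Pn; exists y; rewrite !inE eqxx orbT.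
apply/connected_in_clique/cliqueP => a b; rewrite !inE.
by move=> /orP[]/eqP-> /orP[]/eqP->; rewrite ?eqxx // e_sym.
Qed.

Lemma nonseparable_cycle p : graph_cycle e p -> nonseparable e [set x in p].
Proof.
case/and3P=> p2 cp up; apply/nonseparableP.
have cutp x : x \in p -> exists y q,
    [/\ path e y q, [set w in p] = [set w in x :: y :: q], uniq (x :: y :: q) & e x y].
  case/rot_to=> i r pE; move: up cp p2; rewrite -(rot_uniq i) -(rot_cycle i) -(size_rot i) pE.
  case: r pE => [|y q] pE //= ur /andP[xy]; rewrite rcons_path => /andP[pq _] _.
  by exists y, q; split=> //; apply/setP => w; rewrite !inE -(mem_rot i p w) pE !inE.
have [x xp] : exists x, x \in p by case: p p2 {cp up cutp} => // x p _; exists x; exact: mem_head.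
split.
- by apply/set0Pn; exists x; rewrite inE.
- have [y [q [pq -> _ xy]]] := cutp x xp.
  by apply: connected_in_path; rewrite /= xy.
move=> v; have [vp|vp] := boolP (v \in p); last first.
  rewrite setD1_notin ?inE //.
  have [y [q [pq -> _ xy]]] := cutp x xp.
  by apply: connected_in_path; rewrite /= xy.
have [y [q [pq -> /andP[vq _] _]]] := cutp v vp.
have -> : [set w in [:: v, y & q]] :\ v = [set w in y :: q].
  by apply/setP => w; rewrite !inE; have [->|//] := eqVneq w v; rewrite inE in vq; apply/esym/negbTE.
exact: connected_in_path.
Qed.

(* Equivalent to [block_graph], but easier to maintain when a clique is glued on. *)
Definition all_nonsep_clique A := connected_in e A /\
  forall X, X \subset A -> nonseparable e X -> clique e X.

(** Every nonseparable subset extends to a block, and subsets of cliques are cliques. *)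
Lemma all_nonsep_clique_block_graph A : all_nonsep_clique A <-> block_graph e A.
Proof.
split=> [[cA h]|/andP[cA /forallP h]].
  rewrite /block_graph cA; apply/forallP => B; apply/implyP => /maxsetP[/andP[]].
  by move=> BA nB _; exact: h.
split=> // X XA nX; have [|B mB XB] := @maxset_exists _ (fun A' => (A' \subset A) && nonseparable e A') X.
  by rewrite XA.
by apply: clique_sub XB _; have /implyP/(_ mB) := h B.
Qed.

Lemma all_nonsep_clique1 x : all_nonsep_clique [set x].
Proof.
have c1 : clique e [set x] by apply/cliqueP => a b; rewrite !inE => /eqP-> /eqP->; rewrite eqxx.
split; first exact: connected_in_clique.
by move=> X X1 _; exact: clique_sub X1 c1.
Qed.

(** A nonseparable [X] inside neither [A] nor [S] has vertices on both sides of [z]. No edge of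
    G[X :\ z] leaves [S], so deleting [z] would disconnect [X]. *)
Lemma all_nonsep_clique_attach A S z : all_nonsep_clique A -> clique e S -> A :&: S = [set z] ->
  {in S :\ z & A :\ z, forall x y, ~~ e x y} -> all_nonsep_clique (A :|: S).
Proof.
move=> [cA hA] cS AS noe; have [zA zS] : z \in A /\ z \in S.
  by apply/andP; rewrite -in_setI AS set11.
split.
  by apply: connected_inU => //; [exact: connected_in_clique|rewrite AS; apply/set0Pn; exists z; exact: set11].
move=> X XAS nX.
have [XA|/subsetPn[y yX yA]] := boolP (X \subset A); first exact: hA.
have [XS|/subsetPn[x xX xS]] := boolP (X \subset S); first exact: clique_sub XS cS.
exfalso.
have xA : x \in A by have := subsetP XAS x xX; rewrite inE (negbTE xS) orbF.
have yS : y \in S by have := subsetP XAS y yX; rewrite inE (negbTE yA).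
case/nonseparableP: nX => _ _ /(_ z)/connected_inP.
have xz : x != z by apply: contraNneq xS => ->.
have yz : y != z by apply: contraNneq yA => ->.
move/(_ y x); rewrite !inE xz yz xX yX => /(_ isT isT).
have cl : closed (induced e (X :\ z)) S.
  apply: intro_closed; first exact: connect_induced_sym.
  move=> a b /and3P[]; rewrite !inE => /andP[az aX] /andP[bz bX] ab aS.
  apply: contraTT ab => bS; apply: noe; rewrite !inE ?az ?bz //.
  by have := subsetP XAS b bX; rewrite inE (negbTE bS) orbF.
by move/(closed_connect cl); rewrite yS (negbTE xS).
Qed.

End Nonseparable.

(** * The clique bound *)

Section CliqueCount.
Variables (T : finType) (e : rel T) (s : nat).
Hypotheses (e_sym : symmetric e) (e_irr : irreflexive e) (s_ge2 : 2 <= s).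
Implicit Types (v x y z u : T) (p q D : seq T) (A B C L S Q : {set T}).

Definition cliques_in A : {set {set T}} :=
  [set Q : {set T} | [&& Q \subset A, clique e Q & #|Q| == s]].

Local Notation w := (clique_weight s).

Lemma card_cliques_inD A L :
  #|cliques_in A| = (#|cliques_in (A :\: L)| +
    #|[set Q : {set T} | [&& Q \subset A, clique e Q & #|Q| == s] && ~~ [disjoint Q & L]]|)%N.
Proof.
rewrite -[LHS](cardsID [set Q : {set T} | [disjoint Q & L]]); congr (_ + _)%N.
  apply: eq_card => Q; rewrite !inE subsetD -!andbA.
  by case: (Q \subset A); case: (clique e Q); case: [disjoint Q & L]; rewrite //= ?andbT ?andbF.
by apply: eq_card => Q; rewrite !inE andbC.
Qed.

Lemma cliques_in_no_edge A : {in A &, forall x y, ~~ e x y} -> cliques_in A = set0.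
Proof.
move=> noe; apply/setP => Q; rewrite !inE; apply/negbTE/negP => /and3P[/subsetP QA /cliqueP cQ /eqP sQ].
have /card_gt1P[x [y [xQ yQ xy]]] : 1 < #|Q| by rewrite sQ.
by have := noe _ _ (QA _ xQ) (QA _ yQ); rewrite cQ.
Qed.

(** [catrev p (a :: q)] is [rev p ++ a :: q]: two paths leaving [a] are joined by reversing the
    first. *)
Lemma sorted_catrev a p q : path e a p -> path e a q -> sorted e (catrev p (a :: q)).
Proof.
elim: p a q => //= c p IH a q /andP[ac pp] pq.
by apply: IH => //=; rewrite e_sym ac.
Qed.

(** * Cliques meeting the set of ends of a longest path *)

Section End.
Variables (A S : {set T}) (z : T) (D : seq T).
Hypothesis pe : path_end e A S z D.
Let L := ham_ends e S z.

Lemma end_sub : L \subset S :\ z.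
Proof. exact/ham_ends_sub/(pe_card pe). Qed.

Lemma end_mem y : y \in L -> y \in S /\ y \in A.
Proof.
move=> /(subsetP end_sub); rewrite inE => /andP[_ yS].
by split=> //; apply: (subsetP (pe_sub pe)).
Qed.

Lemma end_root : z \in S :\: L.
Proof.
have [y /ham_endsP[r [_ _ rS lr]]] := set0Pn _ (pe_ends pe).
rewrite inE -rS -{2}lr mem_last andbT; apply/negP => /(subsetP end_sub).
by rewrite !inE eqxx.
Qed.

Lemma end_rootS : z \in S.
Proof. by have := end_root; rewrite inE => /andP[]. Qed.

Let N y := [set x in S | e y x].

(** A clique of G[A] through [y] lies in the closed neighbourhood [B] of [y] in [S]. Enlarging the
    sum to all [s]-subsets of [B] through [y] gives the average of ['C(x, s.-1)] from
    [a = |N y :\: L|] to [d = |N y|]. Here [a + d <= |S|], since [a <= |S :\: L|] trivially and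
    [d <= |L|] by rotation. *)
Lemma end_weight y : y \in L ->
  let f := (\sum_(Q : {set T} | (y \in Q) && [&& Q \subset A, clique e Q & #|Q| == s])
            (#|Q :&: L|%:R^-1 : rat))%R in
  (f <= w #|S|)%R /\ (f = w #|S| -> s <= #|S| -> S :\: L \subset N y /\ #|N y| = #|L|).
Proof.
move=> yL f; have [yS yA] := end_mem yL.
have yN : y \notin N y by rewrite inE e_irr andbF.
pose B := y |: N y; pose M := B :&: L.
have MB : M \subset B by exact: subsetIl.
have yM : y \in M by rewrite in_setI yL setU11.
have NS : N y \subset S :\ y.
  by apply/subsetP => x xN; rewrite in_setD1 (memPn yN) //; move: xN; rewrite inE => /andP[].
have cB : #|B| = #|N y|.+1 by rewrite cardsU1 yN.
have cM : #|M| = (#|N y|.+1 - #|N y :\: L|)%N.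
  have BL : B :\: L = N y :\: L.
    by apply/setP => x; rewrite !in_setD in_setU1; have [->|//] := eqVneq x y; rewrite yL.
  by rewrite -BL -cB -(cardsID L B) addnK.
have cNL : #|N y :\: L| <= #|S :\: L|.
  by apply/subset_leq_card/setSD/subsetP => x; rewrite inE => /andP[].
have aN : #|N y :\: L| <= #|N y| by apply/subset_leq_card/subsetDl.
have f_le : (f <= degree_weight s #|N y :\: L| #|N y|)%R.
  have -> : degree_weight s #|N y :\: L| #|N y| =
    (\sum_(Q : {set T} | [&& y \in Q, Q \subset B & #|Q| == s]) (#|Q :&: M|%:R^-1 : rat))%R.
    rewrite (sum_inv_card_draws s MB yM) /degree_weight cM cB; congr ((_ - _%:R) / _)%R.
    by congr 'C(_, _); lia.
  rewrite /f big_mkcond [leRHS]big_mkcond; apply: ler_sum => Q _.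
  case: ifP => [/and4P[yQ /subsetP QA /cliqueP cQ sQ]|_]; last by case: ifP; rewrite // invr_ge0 ler0n.
  have QB : Q \subset B.
    apply/subsetP => x xQ; rewrite !inE; have [//|xy] := eqVneq x y.
    have yx : e y x by apply: cQ; rewrite // eq_sym.
    by rewrite yx (pe_nbrs pe yL) ?QA.
  rewrite yQ QB sQ /=; have -> // : Q :&: L = Q :&: M.
  by rewrite setIA (setIidPl QB).
have cSL : (#|S :\: L| + #|L|)%N = #|S|.
  rewrite -[RHS](cardsID L S) addnC; congr (_ + _)%N.
  by rewrite (setIidPr _) //; apply: subset_trans end_sub (subD1set _ _).
have dL : #|N y| <= #|L| by exact: ham_ends_degree.
have d0 : 0 < #|N y|.
  have /ham_endsP[[|x r] [pr _ rS lr]] := yL.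
    by have := subsetP end_sub y yL; rewrite !inE -lr eqxx.
  by apply/card_gt0P; exists x; move: pr; rewrite inE -rS !inE eqxx orbT => /andP[-> _].
have dS : #|N y| < #|S|.
  by rewrite (leq_ltn_trans (subset_leq_card NS)) // [ltnRHS](cardsD1 y) yS.
have [le lt] := degree_weight_le_lt s_ge2 aN d0 dS ltac:(lia).
split=> [|fE sS]; first exact: le_trans le.
(* Strictness for [a + d < |S|] forces [a + d = |S|], so both bounds on [a] and [d] are attained. *)
have adS : #|S| <= (#|N y :\: L| + #|N y|)%N.
  by rewrite leqNgt; apply/negP => /lt/(_ sS); rewrite ltNge -fE f_le.
split; last by lia.
have -> : S :\: L = N y :\: L.
  apply/esym/eqP; rewrite eqEcard setSD /=; last by apply/subsetP => x; rewrite inE => /andP[].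
  by lia.
exact: subsetDl.
Qed.

Lemma end_circ y : y \in L -> (w #|S| <= w (circ e A y))%R.
Proof.
move=> /end_mem[yS _]; apply: clique_weight_le => //; first exact: pe_card pe.
exact: pe_circ pe _ yS.
Qed.

Lemma end_cliques :
  (#|[set Q : {set T} | [&& Q \subset A, clique e Q & #|Q| == s] && ~~ [disjoint Q & L]]|%:R
    <= \sum_(y in L) w (circ e A y))%R.
Proof.
rewrite card_meeting; apply: ler_sum => y yL.
have [le _] := end_weight yL; exact: le_trans le (end_circ yL).
Qed.

(** Equality of the sums is equality for each [y], so both links of
    [share <= w |S| <= w (circ e A y)] are tight. The weight is strictly increasing from [s] on,
    which turns equal weights into [circ e A y = |S|]. *)
Lemma end_cliques_eq :
  (#|[set Q : {set T} | [&& Q \subset A, clique e Q & #|Q| == s] && ~~ [disjoint Q & L]]|%:R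
    = \sum_(y in L) w (circ e A y))%R ->
  {in L, forall y, s <= circ e A y} ->
  {in L, forall y, [/\ circ e A y = #|S|, S :\: L \subset N y & #|N y| = #|L|]}.
Proof.
rewrite card_meeting => eq sc y yL.
have h : {in L, forall x, (\sum_(Q : {set T} | (x \in Q) && [&& Q \subset A, clique e Q & #|Q| == s])
   (#|Q :&: L|%:R^-1 : rat) = w (circ e A x))%R}.
  apply: eq_sum_le eq => x xL; have [le _] := end_weight xL.
  exact: le_trans le (end_circ xL).
have [le lt] := end_weight yL; rewrite (h y yL) in le lt.
have cS : circ e A y = #|S|.
  apply/eqP; rewrite eqn_leq (clique_weight_le_inv s_ge2 (pe_card pe) (sc y yL) le).
  by case: (end_mem yL) => yS _; exact: pe_circ pe _ yS.
have [] := lt; [by rewrite cS|by rewrite -cS sc|].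
by split.
Qed.

(** This lets the vertex omitted from the sum survive the deletion of [L]. If a maximiser [u] lies
    in [L] and [circ e A u <= |S|], then [z] is a maximiser too. Otherwise its longest cycle has
    more than [|S|] vertices, hence one outside [L], which is equally good. *)
Lemma end_max_circ : exists2 u, u \in A :\: L & {in A, forall v, circ e A v <= circ e A u}.
Proof.
have zSL := end_root; have zS := end_rootS.
have zA : z \in A by apply: (subsetP (pe_sub pe)).
have zAL : z \in A :\: L by move: zSL; rewrite !in_setD zA => /andP[-> _].
case: (@arg_maxnP _ z [in A] (circ e A) zA) => u uA u_max.
have [uL|uL] := boolP (u \in L); last by exists u; rewrite // in_setD uL.
have [cu|cu] := leqP (circ e A u) #|S|.
  exists z => // v /u_max vu; apply: leq_trans vu (leq_trans cu _).
  exact: pe_circ pe _ zS.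
case: (@circ_witness _ e A u); first exact: leq_ltn_trans (pe_card pe) cu.
move=> p [cp pA up sp].
have /subsetPn[v vp vL] : ~~ ([set x in p] \subset L).
  apply: contraL cu => /subset_leq_card; rewrite -leqNgt -sp cardsE.
  case/and3P: cp => _ _ /card_uniqP-> h; apply: (leq_trans h).
  by apply/subset_leq_card/(subset_trans end_sub)/subD1set.
rewrite inE in vp.
exists v; first by rewrite in_setD vL pA.
by move=> x /u_max xu; apply: leq_trans xu _; rewrite -sp; apply: circ_max.
Qed.

(* Through [y] the clique [C] is tied to the tail [z :: D]: if they are disjoint
   this makes a path that is too long, otherwise a long cycle. *)
Lemma end_long_cycle C x y : y \in L -> C \subset A :\: L -> clique e C -> #|S| <= #|C| ->
  x \in C -> x \in S -> x != z -> e y x -> e y z -> #|S| < circ e A y.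
Proof.
move=> yL /subsetP CA cC SC xC xS xz yx yz.
have [yS yA] := end_mem yL; have zS := end_rootS.
have zA : z \in A by apply: (subsetP (pe_sub pe)).
have CA' c : c \in C -> c \in A by move/CA; rewrite in_setD => /andP[].
have yC : y \notin C by apply/negP => /CA; rewrite in_setD yL.
have [pD uD DA DS] := pe_tail pe.
have zD : z \notin D by apply/negP => /DS; rewrite zS.
have yzD : y \notin z :: D.
  rewrite inE negb_or; apply/andP; split; last by apply/negP => /DS; rewrite yS.
  by have := subsetP end_sub y yL; rewrite inE => /andP[]; rewrite inE.
have xzD : x \notin z :: D.
  by rewrite inE negb_or xz; apply/negP => /DS; rewrite xS.
have [hC|hC] := boolP (has [in C] (z :: D)); last first.
  pose q := enum (C :\ x).
  have xq : x \notin q by rewrite mem_enum !inE eqxx.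
  have memq : x :: q =i C.
    by move=> c; rewrite inE mem_enum !inE; have [->|] := eqVneq c x; rewrite ?xC.
  have uq : uniq (x :: q) by rewrite /= xq enum_uniq.
  have pq : path e x q by apply: clique_path cC _ uq => c; rewrite memq.
  (* Run the tail backwards to [z], then go through [y] and [x] over all of [C]: this path has
     [|D| + |C| + 2] vertices. *)
  have : gpath e A (catrev D (z :: y :: x :: q)).
    apply/and3P; split.
    - by apply: sorted_catrev => //=; rewrite e_sym yz yx.
    - rewrite catrevE -cat_rcons -rev_cons cat_uniq rev_uniq; apply/and3P; split.
      + by rewrite /= zD.
      + apply/hasPn => c; rewrite inE mem_rev => /predU1P[->//|]; rewrite memq => cC'.
        by apply: contra hC => czD; apply/hasP; exists c.
      + by rewrite cons_uniq uq memq yC.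
    apply/allP => c; rewrite catrevE mem_cat mem_rev => /orP[/DA//|].
    by rewrite inE => /predU1P[->//|]; rewrite inE => /predU1P[->//|]; rewrite memq => /CA'.
  move/(pe_longest pe); rewrite catrevE size_cat size_rev.
  have -> : size [:: z, y, x & q] = #|C|.+2 by rewrite /= -(eq_card memq) (card_uniqP uq).
  by rewrite addnC leq_add2r => /leq_trans/(_ SC); rewrite ltnNge leqnSn.
have yzDp : path e y (z :: D) by rewrite /= yz.
have uzD : uniq (z :: D) by rewrite /= zD.
have zDA c : c \in z :: D -> c \in A by rewrite inE => /predU1P[->//|/DA].
(* Let [c] be the first vertex of [C] along the tail. The cycle goes from [y] along the tail to [c],
   over all of [C] to [x], and back to [y]; it contains [C] and [y]. *)
move: (z :: D) hC yzDp uzD zDA yzD xzD => Z hC.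
case: (split_find_nth z hC) => c Z1 Z2 cC' Z1C.
rewrite cat_path rcons_path cat_uniq rcons_uniq => /andP[/andP[pZ1 Z1c] _] /andP[/andP[cZ1 uZ1] _] zDA.
rewrite !mem_cat !mem_rcons !inE !negb_or -!andbA => /and3P[yc yZ1 _] /and3P[xc xZ1 _].
have [q [pq uq qC]] := clique_ham cC cC' xC ltac:(by rewrite eq_sym).
have cycy : graph_cycle e (y :: Z1 ++ c :: rcons q x).
  apply/and3P; split.
  - by rewrite /= size_cat /= size_rcons !addnS.
  - by rewrite /= rcons_path cat_path pZ1 /= Z1c pq last_cat /= last_rcons e_sym yx.
  - rewrite cons_uniq mem_cat negb_or yZ1 qC yC cat_uniq uZ1 uq !andTb andbT; apply/hasPn => b.
    by rewrite qC => bC; apply: contra Z1C => bZ; apply/hasP; exists b.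
apply: (@leq_trans (size (y :: Z1 ++ c :: rcons q x))).
  by rewrite /= size_cat -(card_uniqP uq) (eq_card qC) ltnS (leq_trans SC) // leq_addl.
apply: circ_max => //; last exact: mem_head.
move=> b; rewrite inE => /predU1P[->//|]; rewrite mem_cat qC => /orP[bZ|/CA'//].
by apply: zDA; rewrite mem_cat mem_rcons inE bZ !orbT.
Qed.

End End.

Lemma sum_setD1 A u (F : T -> rat) : u \in A ->
  (\sum_(v in A :\ u) F v = \sum_(v in A) F v - F u)%R.
Proof. by move=> uA; rewrite (big_setD1 u uA) /= addrAC subrr add0r. Qed.

Lemma clique_weight_circ_ge0 A v : (0 <= w (circ e A v))%R.
Proof. exact/clique_weight_ge0/circ_ge2. Qed.

Lemma clique_weight_circ_le A B v : A \subset B -> (w (circ e A v) <= w (circ e B v))%R.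
Proof. by move=> AB; apply: clique_weight_le; [|exact: circ_ge2|exact: circ_le]. Qed.

Lemma ham_ends_proper A S z D : path_end e A S z D ->
  ham_ends e S z \subset A /\ #|A :\: ham_ends e S z| < #|A|.
Proof.
move=> pe; have LA : ham_ends e S z \subset A by apply/subsetP => y /(end_mem pe)[].
split=> //; have [y yL] := set0Pn _ (pe_ends pe); apply: proper_card; apply/properP.
split; first exact: subsetDl.
by exists y; [exact: (subsetP LA)|rewrite in_setD yL].
Qed.

(** Omitting a vertex [u'] of largest [circ] gives the strongest bound, and [u'] can be taken
    outside [L]. The induction hypothesis for [A :\: L] with [u'] omitted is added to the bound for
    cliques meeting [L]; values of [circ] only grow on passing back to [A]. *)
Theorem cliques_in_le A u : u \in A ->
  (#|cliques_in A|%:R <= \sum_(v in A :\ u) w (circ e A v))%R.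
Proof.
have [n] := ubnP #|A|; elim: n => // n IH in A u *; rewrite ltnS => An uA.
have [/exists_inP[x xA /exists_inP[y yA xy]]|noe] := boolP [exists x in A, exists y in A, e x y];
  last first.
  rewrite cliques_in_no_edge ?cards0; last first.
    move=> x y xA yA; apply: contra noe => xy.
    by apply/exists_inP; exists x => //; apply/exists_inP; exists y.
  by apply: sumr_ge0 => v _; exact: clique_weight_circ_ge0.
have [S [z [D pe]]] := path_end_exists e_sym e_irr xA yA xy.
have [u' u'A u'_max] := end_max_circ pe.
set L := ham_ends e S z in u'A.
have [LA ltA] := ham_ends_proper pe.
have le1 := IH _ u' (leq_trans ltA An) u'A.
have le2 := end_cliques pe.
have le3 : (\sum_(v in (A :\: L) :\ u') w (circ e (A :\: L) v) <=
            \sum_(v in (A :\: L) :\ u') w (circ e A v))%R.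
  by apply: ler_sum => v _; exact/clique_weight_circ_le/subsetDl.
have le4 : (w (circ e A u) <= w (circ e A u'))%R.
  by apply: clique_weight_le; rewrite ?circ_ge2 ?u'_max.
rewrite (card_cliques_inD A L) natrD (sum_setD1 _ uA) (big_setID L) /= (setIidPr LA).
rewrite [leRHS](sum_setD1 _ u'A) in le3; rewrite -/L in le2; lra.
Qed.

Theorem cliques_in_eq A u : u \in A -> {in A, forall v, s <= circ e A v} ->
  {in A, forall v, circ e A v <= circ e A u} ->
  (#|cliques_in A|%:R = \sum_(v in A :\ u) w (circ e A v))%R -> all_nonsep_clique e A.
Proof.
have [n] := ubnP #|A|; elim: n => // n IH in A u *; rewrite ltnS => An uA sA u_max eqA.
have w0 v : v \in A -> (0 < w (circ e A v))%R by move/sA; exact: clique_weight_gt0.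
have [/exists_inP[x xA /exists_inP[y yA xy]]|noe] := boolP [exists x in A, exists y in A, e x y];
  last first.
  (* Without edges there are no cliques, while any vertex other than [u] would contribute a positive
     weight. *)
  suff -> : A = [set u] by exact: all_nonsep_clique1.
  apply/eqP; rewrite eqEsubset sub1set uA andbT; apply/subsetP => v vA; rewrite inE.
  apply: contraT => vu; move: eqA; rewrite cliques_in_no_edge ?cards0; last first.
    move=> x y xA yA; apply: contra noe => xy.
    by apply/exists_inP; exists x => //; apply/exists_inP; exists y.
  have vAu : v \in A :\ u by rewrite !inE vu.
  rewrite (big_setD1 v vAu) /= => /esym/eqP; rewrite gt_eqF //.
  apply: ltr_wpDr (w0 _ vA); apply: sumr_ge0 => ? _; exact: clique_weight_circ_ge0.
have [S [z [D pe]]] := path_end_exists e_sym e_irr xA yA xy.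
have [u' u'A u'_max] := end_max_circ pe.
have [LA ltA] := ham_ends_proper pe.
have le2 := end_cliques pe; have eq2 := end_cliques_eq pe.
have [y0 y0L] := set0Pn _ (pe_ends pe).
have SLz := end_root pe; have zS := end_rootS pe; have LSz := end_sub pe.
set L := ham_ends e S z in u'A LA ltA le2 eq2 y0L SLz LSz.
pose A' := A :\: L; rewrite -/A' in u'A ltA.
have A'A : A' \subset A by exact: subsetDl.
have le1 := cliques_in_le u'A.
have le3 v : v \in A' :\ u' -> (w (circ e A' v) <= w (circ e A v))%R.
  by move=> _; exact: clique_weight_circ_le.
have le3' : (\sum_(v in A' :\ u') w (circ e A' v) <= \sum_(v in A' :\ u') w (circ e A v))%R.
  exact: ler_sum.
have eq4 : circ e A u = circ e A u'.
  by apply/eqP; rewrite eqn_leq u'_max // u_max // (subsetP A'A).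
(* Equality makes every estimate in the proof of the bound tight. *)
have {eqA} [eq1 eq3 {}eq2] : [/\ (#|cliques_in A'|%:R = \sum_(v in A' :\ u') w (circ e A' v))%R,
    (\sum_(v in A' :\ u') w (circ e A' v) = \sum_(v in A' :\ u') w (circ e A v))%R &
    {in L, forall y, [/\ circ e A y = #|S|, S :\: L \subset [set x in S | e y x] &
       #|[set x in S | e y x]| = #|L|]}].
  move: eqA; rewrite (card_cliques_inD A L) natrD (sum_setD1 _ uA) (big_setID L) /= (setIidPr LA).
  rewrite -/A' eq4; move=> eqA.
  have e4 := sum_setD1 (fun v => w (circ e A v)) u'A.
  split; [lra|lra|apply: eq2 => [|b bL]; [lra|]].
  exact/sA/(subsetP LA).
have cA' v : v \in A' :\ u' -> circ e A v <= circ e A' v.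
  move=> vA'; apply: (clique_weight_le_inv s_ge2 (circ_ge2 _ _ _)).
    by apply/sA/(subsetP A'A); move: vA'; rewrite in_setD1 => /andP[].
  by rewrite (eq_sum_le le3 eq3).
have sS : s <= #|S| by have [<- _ _] := eq2 _ y0L; exact/sA/(subsetP LA).
have sA' v : v \in A' :\ u' -> s <= circ e A' v.
  move=> vA'; apply: leq_trans (cA' _ vA').
  by apply/sA/(subsetP A'A); move: vA'; rewrite in_setD1 => /andP[].
(* The count attains the bound with [u'] omitted, so the bound with [v] omitted gives
   [w (circ e A' v) <= w (circ e A' u')]. *)
have u'_max' v : v \in A' :\ u' -> circ e A' v <= circ e A' u'.
  move=> vA'u'; have vA' : v \in A' by move: vA'u'; rewrite in_setD1 => /andP[].
  apply: (clique_weight_le_inv s_ge2 (circ_ge2 _ _ _)); first exact: sA'.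
  have := cliques_in_le vA'.
  by rewrite eq1 (sum_setD1 _ u'A) (sum_setD1 _ vA') lerD2l lerN2.
have BA' : all_nonsep_clique e A'.
  have [A'u'|/set0Pn[x' x'A']] := eqVneq (A' :\ u') set0.
    suff -> : A' = [set u'] by exact: all_nonsep_clique1.
    by rewrite -(setD1K u'A) A'u' setU0.
  apply: (IH A' u' (leq_trans ltA An) u'A _ _ eq1) => v vA'.
    (* The omitted vertex [u'] has no term in the sum; its value is at least that of another vertex
       [x'] of [A']. *)
    have [->|vu'] := eqVneq v u'; first exact: leq_trans (sA' _ x'A') (u'_max' _ x'A').
    by apply: sA'; rewrite in_setD1 vu'.
  by have [->//|vu'] := eqVneq v u'; apply: u'_max'; rewrite in_setD1 vu'.
have SA := subsetP (pe_sub pe).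
(* A second vertex [x'] of [S :\: L] would lie on a cycle of G[A'] of length at least [|S|], whose
   vertices form a clique. Since [y0] is adjacent to [x'] and [z], [end_long_cycle] would give
   [circ e A y0 > |S|]. *)
have SL : S :\: L = [set z].
  apply/eqP; rewrite eqEsubset sub1set SLz andbT; apply/subsetP => x' x'SL; rewrite inE.
  apply: contraT => x'z; have [x'S x'L] : x' \in S /\ x' \notin L.
    by move: x'SL; rewrite in_setD => /andP[].
  have mA' v : v \in S :\: L -> v \in A'.
    by rewrite !in_setD => /andP[-> /SA].
  have big v : v \in S :\: L -> v != u' -> #|S| <= circ e A' v.
    move=> vSL vu'; apply: leq_trans (cA' v _); last by rewrite in_setD1 vu' mA'.
    by apply: (pe_circ pe); move: vSL; rewrite in_setD => /andP[].
  (* If [x'] is the omitted vertex [u'], then [z] is not, and maximality of [u'] carries the bound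
     over from [z]. *)
  have big' : #|S| <= circ e A' x'.
    have [xu|] := eqVneq x' u'; last exact: big.
    have zu : z != u' by rewrite -xu eq_sym.
    by rewrite xu; apply: leq_trans (big z SLz zu) (u'_max' _ _); rewrite in_setD1 zu mA'.
  have S3 : 2 < #|S|.
    rewrite -(cardsID L S) -addn1 addnC leq_add ?card_gt0 //.
      by apply/set0Pn; exists y0; rewrite in_setI y0L andbT; have := subsetP LSz _ y0L; rewrite in_setD1 => /andP[].
    by apply/card_gt1P; exists x', z.
  have [p [cp pA' x'p sp]] := circ_witness (leq_trans S3 big').
  have cC : clique e [set c in p].
    apply: BA'.2; first by apply/subsetP => c; rewrite inE => /pA'.
    exact: nonseparable_cycle.
  have [cy0 /subsetP Ny0 _] := eq2 _ y0L.
  have Ny0' v : v \in S :\: L -> e y0 v by move/Ny0; rewrite inE => /andP[].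
  have := @end_long_cycle A S z D pe [set c in p] x' y0 y0L _ cC _ _ x'S x'z (Ny0' _ x'SL) (Ny0' _ SLz).
  rewrite cy0 ltnn; apply.
  - by apply/subsetP => c; rewrite inE => /pA'.
  - by case/and3P: cp => _ _ /card_uniqP up; rewrite cardsE up sp.
  - by rewrite inE.
have cSL : #|S| = #|L|.+1.
  rewrite -(cardsID L S) SL cards1 addn1 (setIidPr _) //.
  exact: subset_trans LSz (subD1set _ _).
have memL v : v \in S -> v != z -> v \in L.
  move=> vS vz; apply: contraNT vz => vL.
  have : v \in S :\: L by rewrite in_setD vL.
  by rewrite SL inE.
(* A vertex of [L] has [|L| = |S| - 1] neighbours in [S], hence is adjacent to all other vertices of
   [S]. *)
have adj a b : a \in L -> b \in S -> a != b -> e a b.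
  move=> aL bS ab; have [_ _ cN] := eq2 _ aL.
  have aS : a \in S by have := subsetP LSz _ aL; rewrite in_setD1 => /andP[].
  have : [set v in S | e a v] == S :\ a.
    rewrite eqEcard cN; have := cardsD1 a S; rewrite aS cSL add1n => -[->]; rewrite leqnn andbT.
    apply/subsetP => v; rewrite !inE => /andP[-> av]; rewrite andbT.
    by apply: contraTneq av => ->; rewrite e_irr.
  by move/eqP/setP/(_ b); rewrite !inE bS eq_sym ab /= => ->.
have cS : clique e S.
  apply/cliqueP => a b aS bS ab.
  have [az|az] := eqVneq a z; last by apply: adj; rewrite // memL.
  by rewrite e_sym; apply: adj; rewrite ?memL // -1?az eq_sym.
have AE : A = A' :|: S.
  apply/setP => v; rewrite in_setU in_setD; have [vL|vL] /= := boolP (v \in L).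
    by rewrite (subsetP LA) //; apply/esym; have := subsetP LSz _ vL; rewrite in_setD1 => /andP[].
  by case: (boolP (v \in S)) => [/SA->|_]; rewrite ?orbT ?orbF.
have A'S : A' :&: S = [set z].
  by rewrite -SL setIC; apply/setP => v; rewrite !in_setI !in_setD; case: (boolP (v \in S)) => [/SA->|]; rewrite ?andbF ?andbT.
rewrite AE; apply: (all_nonsep_clique_attach e_sym BA' cS A'S) => a b.
rewrite !in_setD1 in_setD => /andP[az aS] /and3P[bz bL bA]; apply: contra bL => ab.
by apply: (memL b) => //; apply: (pe_nbrs pe (memL _ aS az) bA).
Qed.

End CliqueCount.

(** * Rooted block trees *)

Section Distance.
Variables (U : finType) (r : rel U).
Implicit Types (x y z : U) (p : seq U).

Lemma distance_le x p : path r x p -> distance r x (last x p) <= size p.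
Proof.
move=> pp; rewrite leqNgt; apply/negP => lt.
have lt' : size p < #|U|.+1.
  by apply: leq_trans lt _; rewrite -[leqRHS](size_iota 0); exact: find_size.
have := before_find 0 lt; rewrite nth_iota // add0n => /existsP[].
by exists (in_tuple p); rewrite pp eqxx.
Qed.

(** A path without repetition has fewer than [|U|] edges, so the search in [distance] succeeds
    within its range. *)
Lemma distance_path x y : connect r x y ->
  exists p, [/\ path r x p, last x p = y & size p = distance r x y].
Proof.
case/connectP=> p0 /shortenP[p pp up _] ->.
have lt : size p < #|U| by rewrite -ltnS -[(size p).+1]/(size (x :: p)) -(card_uniqP up) ltnS max_card.
have hp : has (fun n => [exists q : n.-tuple U, path r x q && (last x q == last x p)]) (iota 0 #|U|.+1).
  apply/hasP; exists (size p); first by rewrite mem_iota /= add0n ltnS ltnW.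
  by apply/existsP; exists (in_tuple p); rewrite pp eqxx.
have := hp; rewrite has_find size_iota => lt_find.
have := nth_find 0 hp; rewrite nth_iota // add0n.
case/existsP=> q /andP[pq /eqP lq]; exists q; split=> //; exact: size_tuple.
Qed.

Lemma distancexx x : distance r x x = 0.
Proof. by apply/eqP; rewrite -leqn0; apply: (@distance_le x [::]). Qed.

Lemma distance_eq0 x y : connect r x y -> distance r x y = 0 -> x = y.
Proof. by case/distance_path=> -[|z p] [_ /= xy <-]. Qed.

Lemma distance_step x y z : connect r x y -> r y z -> distance r x z <= (distance r x y).+1.
Proof.
case/distance_path=> p [pp lp <-] yz.
rewrite -(size_rcons p z) -{1}(last_rcons x p z); apply: distance_le.
by rewrite rcons_path pp lp.
Qed.

Lemma distance_pred x y : connect r x y -> x != y ->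
  exists z, [/\ connect r x z, r z y & distance r x y = (distance r x z).+1].
Proof.
case/distance_path=> p [+ + sp]; case: (lastP p) sp => [|q z] sp pp lp; first by rewrite -lp eqxx.
move: pp lp sp; rewrite rcons_path last_rcons size_rcons => /andP[pq qz] zy sp xy.
rewrite {z}zy in qz; have cq : connect r x (last x q) by apply/connectP; exists q.
exists (last x q); split=> //; apply/eqP; rewrite eqn_leq distance_step //=.
by rewrite -sp ltnS distance_le.
Qed.

End Distance.

Section BlockTree.
Variables (T : finType) (e : rel T) (H : {set T}).
Hypotheses (e_sym : symmetric e) (e_irr : irreflexive e) (nsc : all_nonsep_clique e H).
Implicit Types (v x y z : T) (p q : seq T) (B C P X : {set T}).

Lemma blockP B : block e H B ->
  [/\ B \subset H, nonseparable e B, clique e B & exists x, x \in B].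
Proof.
case/maxsetP=> /andP[BH nB] _; split=> //; first exact: nsc.2.
by case/nonseparableP: nB => /set0Pn.
Qed.

Lemma block_mem B x : block e H B -> x \in B -> x \in H.
Proof. by case/blockP=> /subsetP BH _ _ _; exact: BH. Qed.

Lemma block_max B X : block e H B -> X \subset H -> nonseparable e X -> B \subset X -> X = B.
Proof. by case/maxsetP=> _ max XH nX; apply: max; rewrite XH. Qed.

Lemma block_exists X : X \subset H -> nonseparable e X -> exists2 B, block e H B & X \subset B.
Proof.
move=> XH nX; have [|B mB XB] := @maxset_exists _ (fun A => (A \subset H) && nonseparable e A) X.
  by rewrite XH.
by exists B.
Qed.

Lemma edge_block x y : x \in H -> y \in H -> e x y ->
  exists2 B, block e H B & x \in B /\ y \in B.
Proof.
move=> xH yH xy; have [||B bB /subsetP xyB] := @block_exists [set x; y].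
- by rewrite subUset !sub1set xH.
- apply: nonseparable_clique; first by apply/set0Pn; exists x; rewrite set21.
  apply/cliqueP => a b; rewrite !inE => /orP[]/eqP-> /orP[]/eqP->; rewrite ?eqxx //.
  by rewrite e_sym.
by exists B; rewrite ?xyB ?set21 ?set22.
Qed.

Lemma vertex_block x : x \in H -> exists2 B, block e H B & x \in B.
Proof.
move=> xH; have [||B bB xB] := @block_exists [set x].
- by rewrite sub1set.
- apply: nonseparable_clique; first by apply/set0Pn; exists x; rewrite set11.
  by apply/cliqueP => a b; rewrite !inE => /eqP-> /eqP->; rewrite eqxx.
by exists B; rewrite // -sub1set.
Qed.

Lemma blockU_eq B X : block e H B -> X \subset H -> nonseparable e X -> 1 < #|B :&: X| ->
  X \subset B.
Proof.
move=> bB XH nX BX; have [BH nB _ _] := blockP bB.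
rewrite -(block_max bB _ (nonseparableU e_sym nB nX BX) (subsetUl _ _)) ?subsetUr //.
by rewrite subUset BH.
Qed.

Lemma block_eq B C x y : block e H B -> block e H C ->
  x \in B -> y \in B -> x \in C -> y \in C -> x != y -> B = C.
Proof.
move=> bB bC xB yB xC yC xy; have [CH nC _ _] := blockP bC.
have CB : C \subset B.
  by apply: blockU_eq => //; apply/card_gt1P; exists x, y; rewrite !inE xB xC yB yC.
have [BH nB _ _] := blockP bB; exact: block_max bC BH nB CB.
Qed.

Definition off_block B : rel T := [rel x y | induced e H x y && ~~ ((x \in B) && (y \in B))].

Lemma off_block_connect_sym B : connect_sym (off_block B).
Proof.
by apply: sym_connect_sym => x y; rewrite /off_block /= (induced_sym e_sym) [(x \in B) && _]andbC.
Qed.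

(** Cut the path at its first return [c] to [B]. It is not a single edge, so the edge between [c]
    and [x] in the clique [B] closes it to a cycle sharing two vertices with [B]. By maximality of
    [B] the cycle lies in [B], although its inner vertices do not. *)
Lemma off_block_separated B x y : block e H B -> x \in B -> y \in B ->
  connect (off_block B) x y -> x = y.
Proof.
move=> bB xB yB /connectP[p0 /shortenP[p pp up _] ly]; apply/eqP; apply: contraT => xy.
have [BH nB cB _] := blockP bB.
have hp : has [in B] p.
  apply/hasP; exists y => //; move: xy; rewrite ly.
  by case: (p) => [|z q]; rewrite /= ?eqxx ?mem_last.
move: pp up {ly}; case: (split_find_nth x hp) => c p1 p2 cB' p1B.
rewrite cat_path -cat_cons cat_uniq => /andP[pp _] /andP[uc _].
have xc : x != c by move: uc; rewrite /= mem_rcons inE negb_or => /andP[/andP[]].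
have [pe pH] : path e x (rcons p1 c) /\ {subset rcons p1 c <= H}.
  move: pp; elim: (rcons p1 c) (x) => //= a l IH b /andP[/andP[/and3P[_ aH ->] _] /IH[-> lH]].
  by split=> // d; rewrite inE => /predU1P[->//|/lH].
case: p1 p1B pp uc pe pH => [|a p1] p1B pp uc pe pH.
  by move: pp; rewrite /= /off_block /= xB [c \in B]cB' !andbF.
have cyc : graph_cycle e (x :: rcons (a :: p1) c).
  apply/and3P; split=> //; first by rewrite /= size_rcons.
  by rewrite /cycle rcons_path pe last_rcons; apply: (cliqueP _ _ cB); rewrite // eq_sym.
have XB := @blockU_eq B [set v in x :: rcons (a :: p1) c] bB _ (nonseparable_cycle e_sym cyc).
have aB : a \in B.
  apply: (subsetP (XB _ _)); last by rewrite !inE eqxx orbT.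
    by apply/subsetP => v; rewrite inE inE => /predU1P[->|/pH//]; apply: (subsetP BH).
  apply/card_gt1P; exists x, c; split=> //.
    by rewrite in_setI xB inE mem_head.
  by rewrite in_setI [c \in B]cB' inE inE mem_rcons mem_head orbT.
by move: p1B; rewrite /= aB.
Qed.

Lemma off_block_within B C x y : block e H B -> block e H C -> C != B -> x \in C -> y \in C ->
  connect (off_block B) x y.
Proof.
move=> bB bC CB xC yC; have [->|xy] := eqVneq x y; first exact: connect0.
have [_ _ /cliqueP cC _] := blockP bC.
apply: connect1; rewrite /off_block /induced /= !(block_mem bC) // cC //=.
by apply: contra CB => /andP[xB yB]; apply/eqP; exact: block_eq xC yC xB yB xy.
Qed.

Lemma block_adj_sharing B C x : block e H B -> block e H C -> x \in B -> x \in C ->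
  connect (block_adj e H) B C.
Proof.
move=> bB bC xB xC; have [->|BC] := eqVneq B C; first exact: connect0.
apply: connect1; rewrite /block_adj bB bC BC /=; apply/set0Pn; exists x.
by rewrite inE xB.
Qed.

Lemma block_adj_connect B C : block e H B -> block e H C -> connect (block_adj e H) B C.
Proof.
move=> bB bC; have [_ _ _ [x xB]] := blockP bB; have [_ _ _ [y yC]] := blockP bC.
have /connected_inP/(_ x y) := nsc.1; rewrite (block_mem bB) // (block_mem bC) // => /(_ isT isT).
case/connectP=> p pp ly; elim: p x B xB bB pp ly => [|z p IH] x B xB bB /=.
  by move=> _ yx; apply: block_adj_sharing xB _ => //; rewrite -yx.
case/andP=> /and3P[xH zH xz] pp ly; have [E bE [xE zE]] := edge_block xH zH xz.
exact: connect_trans (block_adj_sharing bB bE xB xE) (IH z E zE bE pp ly).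
Qed.

(** * Depths and top blocks *)

Section Rooted.
Variable R : {set T}.
Hypothesis bR : block e H R.
Let d B := distance (block_adj e H) R B.

Lemma depth_sharing B C x : block e H B -> block e H C -> x \in B -> x \in C -> d C <= (d B).+1.
Proof.
move=> bB bC xB xC; have [->|BC] := eqVneq B C; first exact: leqnSn.
apply: distance_step; first exact: block_adj_connect.
by rewrite /block_adj bB bC BC; apply/set0Pn; exists x; rewrite inE xB.
Qed.

Lemma depth_eq0 B : block e H B -> d B = 0 -> B = R.
Proof. by move=> bB dB; apply/esym; apply: distance_eq0 dB; exact: block_adj_connect. Qed.

Lemma block_parent B : block e H B -> B != R ->
  exists P x, [/\ block e H P, x \in P, x \in B & d B = (d P).+1].
Proof.
move=> bB BR; have [|P [_ /and4P[bP _ _ /set0Pn[x]]]] := distance_pred (block_adj_connect bR bB).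
  by rewrite eq_sym.
by rewrite inE => /andP[xP xB] dB; exists P, x.
Qed.

(** Passing from [C] to parents lowers the depth strictly, so the root is reached without using
    [B]. *)
Lemma off_block_root B C x r0 : block e H B -> block e H C -> C != B -> d C <= d B ->
  x \in C -> r0 \in R -> connect (off_block B) x r0.
Proof.
move=> bB + + + + r0R; have [n] := ubnP (d C); elim: n => // n IH in C x *.
rewrite ltnS => Cn bC CB CdB xC; have [CR|CR] := eqVneq C R.
  by apply: off_block_within bB bC CB xC _; rewrite CR.
have [P [y [bP yP yC dC]]] := block_parent bC CR.
apply: connect_trans (off_block_within bB bC CB xC yC) _.
apply: (IH P y); rewrite -?dC //; last by apply: ltnW; rewrite -dC.
by apply: contraTneq CdB => <-; rewrite dC -ltnNge.
Qed.

(** Both vertices are joined to the root off [B], hence to each other, and [off_block_separated]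
    identifies them. Thus [B] meets the other blocks of no greater depth in at most one vertex
    altogether. *)
Lemma attach_unique B C C' x x' : block e H B -> block e H C -> block e H C' ->
  x \in B -> x' \in B -> x \in C -> x' \in C' -> C != B -> C' != B -> d C <= d B -> d C' <= d B ->
  x = x'.
Proof.
move=> bB bC bC' xB x'B xC x'C' CB C'B dC dC'; have [_ _ _ [r0 r0R]] := blockP bR.
apply: (off_block_separated bB xB x'B).
apply: connect_trans (off_block_root bB bC CB dC xC r0R) _.
by rewrite off_block_connect_sym; apply: off_block_root C'B dC' x'C' r0R.
Qed.

Definition is_top v B :=
  [&& block e H B, v \in B & [forall C, (block e H C && (v \in C)) ==> (d B <= d C)]].

Lemma is_topP v B : reflect
  [/\ block e H B, v \in B & forall C, block e H C -> v \in C -> d B <= d C] (is_top v B).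
Proof.
apply: (iffP and3P) => -[bB vB h]; split=> //.
  by move=> C bC vC; have /forallP/(_ C) := h; rewrite bC vC.
by apply/forallP => C; apply/implyP => /andP[]; exact: h.
Qed.

(** If [B != C] and [B] is not the root, [C] and the parent of [B] meet [B] in the same vertex,
    namely [v]; so the parent contains [v] at smaller depth. *)
Lemma is_top_unique v B C : is_top v B -> is_top v C -> B = C.
Proof.
move=> /is_topP[bB vB hB] /is_topP[bC vC hC]; apply/eqP; apply: contraT => BC.
have [BR|BR] := eqVneq B R.
  have := hC _ bB vB; rewrite BR [X in _ <= X]distancexx leqn0 => /eqP/(depth_eq0 bC) CR.
  by rewrite BR CR eqxx in BC.
have [P [x [bP xP xB dB]]] := block_parent bB BR.
suff xv : x = v by have := hB _ bP; rewrite -xv dB ltnn => /(_ xP).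
apply: (attach_unique bB bP bC) => //; rewrite ?hC ?dB //; last by rewrite eq_sym.
by apply/eqP => PB; have := leqnn (d P); rewrite {1}PB dB ltnn.
Qed.

Definition top v := odflt set0 [pick B | is_top v B].

Lemma topP v : v \in H -> is_top v (top v).
Proof.
move=> vH; rewrite /top; case: pickP => [//|no].
have [B bB vB] := vertex_block vH; have PB : block e H B && (v \in B) by rewrite bB.
case: (@arg_minnP _ B (fun C => block e H C && (v \in C)) d PB) => C /andP[bC vC] minC.
have /is_topP[] := no C; split=> // E bE vE; apply: minC; by rewrite bE.
Qed.

Lemma topE v B : is_top v B -> top v = B.
Proof.
move=> tB; apply: (is_top_unique (topP _) tB).
by case/is_topP: tB => bB vB _; exact: block_mem vB.
Qed.

Lemma top_root v : v \in R -> top v = R.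
Proof. by move=> vR; apply/topE/is_topP; split=> // C _ _; rewrite [d R]distancexx. Qed.

Lemma card_top_fibre r0 B : r0 \in R -> block e H B ->
  #|[set v in H :\ r0 | top v == B]| = #|B|.-1.
Proof.
move=> r0R bB; have [x xB xE] : exists2 x, x \in B &
    [set v in H :\ r0 | top v == B] = B :\ x; last by rewrite xE [#|B|](cardsD1 x) xB.
have sub v : v \in H -> top v = B -> v \in B by move=> /topP/is_topP[_ + _] <-.
have [BR|BR] := eqVneq B R.
  exists r0; first by rewrite BR.
  apply/setP => v; rewrite !inE -andbA; case: eqVneq => //= _.
  apply/andP/idP => [[vH /eqP]|vB]; first exact: sub.
  by rewrite (block_mem bB) // top_root -?BR.
have [P [x [bP xP xB dB]]] := block_parent bB BR.
have PB : P != B by apply/eqP => PB; have := leqnn (d P); rewrite {1}PB dB ltnn.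
have dPB : d P <= d B by rewrite dB.
exists x => //; apply/setP => v; rewrite in_set !in_setD1.
apply/andP/andP => [[/andP[vr vH] /eqP tv]|[vx vB]].
  split; last exact: sub.
  apply/eqP => vx; have /is_topP[_ _ /(_ P bP)] := topP vH.
  by rewrite vx xP -vx tv dB ltnn => /(_ isT).
have vH := block_mem bB vB.
have RB : R != B by rewrite eq_sym.
have dRB : d R <= d B by rewrite [d R]distancexx.
split.
  (* Removing [r0] costs no further vertex: if [r0] lies in [B], then it is the attaching vertex
     [x]. *)
  rewrite vH andbT; apply: contraNneq vx => vr.
  by apply/eqP; apply: (attach_unique bB bR bP); rewrite ?vr // -vr.
have /is_topP[bt vt mt] := topP vH.
have [//|tB] := eqVneq (top v) B.
by case/eqP: vx; apply: (attach_unique bB bt bP) => //; exact: mt.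
Qed.

Lemma parent_block_top P B : parent_block e H R P B ->
  exists v, [/\ v \in H, v \in B, block e H B & top v = P].
Proof.
case/andP=> /and4P[bP bB _ /set0Pn[v /setIP[vP vB]]] /eqP dB.
have vH := block_mem bB vB; exists v; split=> //; apply/topE/is_topP; split=> // C bC vC.
by rewrite -ltnS -dB; exact: depth_sharing bC bB vC vB.
Qed.

Lemma top_parent_block v B : block e H B -> v \in B -> top v != B ->
  parent_block e H R (top v) B.
Proof.
move=> bB vB tB; have /is_topP[bt vt mt] := topP (block_mem bB vB).
rewrite /parent_block /block_adj bt bB tB /= -/(d B) -/(d (top v)).
apply/andP; split; first by apply/set0Pn; exists v; rewrite inE vt.
rewrite eqn_leq (depth_sharing bt bB vt vB) ltn_neqAle mt // andbT.
apply: contra tB => /eqP dE; apply/eqP/topE/is_topP; split=> // C bC vC.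
by rewrite -dE mt.
Qed.

(** The top block of a vertex of [B] is [B] itself or a parent of [B], and every parent arises in
    this way. *)
Lemma parent_dominatedP :
  (forall B P, parent_block e H R P B -> #|B| <= #|P|) <->
  (forall v B, block e H B -> v \in B -> #|B| <= #|top v|).
Proof.
split=> [dom v B bB vB|dom B P /parent_block_top[v [_ vB bB <-]]]; last exact: dom.
by have [->//|tB] := eqVneq (top v) B; apply: dom; exact: top_parent_block.
Qed.

End Rooted.

(** * Counting cliques block by block *)

Section BlockCount.
Variable s : nat.
Hypothesis s_ge2 : 2 <= s.
Local Notation w := (clique_weight s).

(** Two blocks share at most one vertex, so a clique on at least two vertices lies in exactly one
    block. *)
Lemma card_cliques_in_blocks :
  #|cliques_in e s H| = \sum_(B | block e H B) 'C(#|B|, s).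
Proof.
rewrite -sum1_card.
transitivity (\sum_(Q in cliques_in e s H) \sum_(B | block e H B && (Q \subset B)) 1).
  apply: eq_bigr => Q; rewrite inE => /and3P[QH cQ /eqP sQ].
  have /card_gt1P[x [y [xQ yQ xy]]] : 1 < #|Q| by rewrite sQ.
  have [|B bB /subsetP QB] := block_exists QH (nonseparable_clique _ cQ).
    by apply/set0Pn; exists x.
  rewrite (big_pred1 B) // => C; apply/andP/eqP => [[bC /subsetP QC]|->]; last first.
    by split=> //; apply/subsetP.
  by apply: (block_eq bC bB _ _ _ _ xy); rewrite ?QB ?QC.
rewrite (exchange_big_dep (block e H)) /=; last by move=> Q B _ /andP[].
apply: eq_bigr => B bB; have [/subsetP BH _ cB _] := blockP bB.
rewrite sum1_card -cards_draws -[RHS]sum1_card -sum1_card; apply: eq_bigl => Q.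
rewrite !inE unfold_in bB /= inE; case: (boolP (Q \subset B)) => [QB|]; last by rewrite andbF.
by rewrite (clique_sub QB cB) (subset_trans QB) ?andbT //; apply/subsetP.
Qed.

Lemma cliques_in_top R r0 : block e H R -> r0 \in R ->
  (#|cliques_in e s H|%:R = \sum_(v in H :\ r0) w #|top R v|)%R.
Proof.
move=> bR r0R; rewrite card_cliques_in_blocks natr_sum.
rewrite (partition_big (top R) (block e H)) /=; last first.
  by move=> v; rewrite in_setD1 => /andP[_ /(topP R)/is_topP[]].
apply: eq_bigr => B bB.
rewrite (eq_bigr (fun=> w #|B|)); last by move=> v /andP[_ /eqP->].
have -> : (\sum_(v in H :\ r0 | top R v == B) w #|B| =
           \sum_(v in [set v in H :\ r0 | top R v == B]) w #|B|)%R.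
  by apply: eq_bigl => v; rewrite !inE.
rewrite sumr_const (card_top_fibre bR r0R bB) -[RHS]mulr_natr.
have [_ _ _ [x xB]] := blockP bB.
have : 0 < #|B| by apply/card_gt0P; exists x.
(* For [|B| = 1] the weight has denominator 0, but the fibre is empty and ['C(1, s) = 0]. *)
rewrite leq_eqVlt => /predU1P[<-|B2]; last by rewrite clique_weightE.
by rewrite mulr0 bin_small.
Qed.

Lemma block_circ B v : block e H B -> v \in B -> #|B| <= circ e H v.
Proof.
move=> bB vB; have [/subsetP BH _ cB _] := blockP bB.
have [B2|B3] := leqP #|B| 2; first exact: leq_trans B2 (circ_ge2 _ _ _).
have [p [cp pB <-]] := clique_graph_cycle cB B3.
by apply: circ_max => // [x|]; rewrite pB //; exact: BH.
Qed.

Hypothesis H_gt1 : 1 < #|H|.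

Lemma neighbour_exists v : v \in H -> exists2 x, x \in H & e v x.
Proof.
move=> vH; have : 0 < #|H :\ v| by move: H_gt1; rewrite (cardsD1 v) vH.
case/card_gt0P=> x; rewrite in_setD1 => /andP[xv xH].
have /connected_inP/(_ v x vH xH)/connectP[p] := nsc.1.
case: p => [_ /= xv'|y p /= /andP[/and3P[_ yH vy] _] _]; first by rewrite xv' eqxx in xv.
by exists y.
Qed.

(** A cycle is nonseparable, hence inside a block; for the value 2 a block containing an edge at [v]
    serves. Conversely a block, being a clique, has a Hamiltonian cycle once it has three
    vertices. *)
Lemma circ_block v : v \in H -> exists2 B, block e H B /\ v \in B & #|B| = circ e H v.
Proof.
move=> vH; suff [B [bB vB] cB] : exists2 B, block e H B /\ v \in B & circ e H v <= #|B|.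
  by exists B => //; apply/eqP; rewrite eqn_leq cB block_circ.
have := circ_ge2 e H v; rewrite leq_eqVlt => /predU1P[<-|/circ_witness[p [cp pH vp <-]]].
  have [x xH vx] := neighbour_exists vH; have [B bB [vB xB]] := edge_block vH xH vx.
  exists B => //; apply/card_gt1P; exists v, x; split=> //.
  by apply: contraTneq vx => ->; rewrite e_irr.
have [||B bB /subsetP pB] := @block_exists [set x in p].
- by apply/subsetP => x; rewrite inE => /pH.
- exact: nonseparable_cycle.
exists B; first by split=> //; apply: pB; rewrite inE.
case/and3P: cp => _ _ /card_uniqP<-.
by apply: subset_leq_card; apply/subsetP => x xp; apply: pB; rewrite inE.
Qed.

Lemma block_gt1 B : block e H B -> 1 < #|B|.
Proof.
move=> bB; have [BH nB _ [v vB]] := blockP bB; have vH := block_mem bB vB.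
have [x xH vx] := neighbour_exists vH; have [C bC [vC xC]] := edge_block vH xH vx.
have vNx : v != x by apply: contraTneq vx => ->; rewrite e_irr.
rewrite ltnNge; apply/negP => B1.
have Bv : B = [set v].
  by apply/esym/eqP; rewrite eqEcard sub1set vB cards1.
have [CH nC _ _] := blockP bC.
have CB : C = B by apply: (block_max bB CH nC); rewrite Bv sub1set.
by move: xC; rewrite CB Bv inE eq_sym (negbTE vNx).
Qed.

(** Since [|top v| <= circ e H v], the sums agree iff all terms do, that is, iff each top block is a
    largest block at its vertex. *)
Lemma parent_dominated_iff R r0 : block e H R -> (forall B, block e H B -> #|B| <= #|R|) ->
  r0 \in R -> {in H, forall v, s <= circ e H v} ->
  ((forall B P, parent_block e H R P B -> #|B| <= #|P|) <->
   (#|cliques_in e s H|%:R = \sum_(v in H :\ r0) w (circ e H v))%R).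
Proof.
move=> bR R_max r0R sH; rewrite parent_dominatedP // (cliques_in_top bR r0R).
split=> [dom|eqs v B bB vB].
  apply: eq_bigr => v; rewrite in_setD1 => /andP[_ vH]; congr (w _).
  have /is_topP[bt vt _] := topP R vH; have [B [bB vB] cB] := circ_block vH.
  by apply/eqP; rewrite eqn_leq block_circ // -cB dom.
have vH := block_mem bB vB; have /is_topP[bt vt _] := topP R vH.
(* The sum says nothing about [r0], but its top block is the root, which is largest. *)
have [->|vr] := eqVneq v r0; first by rewrite top_root ?R_max.
apply: leq_trans (block_circ bB vB) _.
apply: (clique_weight_le_inv s_ge2 (block_gt1 bt) (sH _ vH)).
rewrite -(eq_sum_le _ eqs) // ?in_setD1 ?vr // => x; rewrite in_setD1 => /andP[_ xH].
have /is_topP[bx xx _] := topP R xH.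
by apply: clique_weight_le; [|exact: block_gt1|exact: block_circ].
Qed.

Lemma max_block_circ (R : {set T}) r0 v : (forall B, block e H B -> #|B| <= #|R|) -> block e H R ->
  r0 \in R -> v \in H -> circ e H v <= circ e H r0.
Proof.
move=> R_max bR r0R /circ_block[B [bB _] <-].
exact: leq_trans (R_max B bB) (block_circ bR r0R).
Qed.

End BlockCount.
End BlockTree.

(** * Equality *)

Section BlockGraphEquality.
Variables (T : finType) (e : rel T) (s : nat) (H : {set T}) (u : T).
Hypotheses (e_sym : symmetric e) (e_irr : irreflexive e) (s_ge2 : 2 <= s).
Hypotheses (uH : u \in H) (sH : {in H, forall v, s <= circ e H v}).
Hypothesis u_max : {in H, forall v, circ e H v <= circ e H u}.
Local Notation w := (clique_weight s).

Lemma max_block_exists :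
  exists2 R, block e H R & forall B, block e H B -> #|B| <= #|R|.
Proof.
have c1 : clique e [set u] by apply/cliqueP => a b; rewrite !inE => /eqP-> /eqP->; rewrite eqxx.
have n1 : nonseparable e [set u].
  by apply: nonseparable_clique => //; apply/set0Pn; exists u; rewrite set11.
have [|B0 bB0 _] := @maxset_exists _ (fun A => (A \subset H) && nonseparable e A) [set u].
  by rewrite sub1set uH.
by case: (@arg_maxnP _ B0 (block e H) (fun B : {set T} => #|B|) bB0) => R; exists R.
Qed.

(** Both [u] and a vertex [r0] of the largest block [R] have maximal [circ], so either may be
    omitted from the sum. *)
Lemma parent_dominated_rooted R : all_nonsep_clique e H -> block e H R ->
  (forall B, block e H B -> #|B| <= #|R|) ->
  ((forall B P, parent_block e H R P B -> #|B| <= #|P|) <->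
   (#|cliques_in e s H|%:R = \sum_(v in H :\ u) w (circ e H v))%R).
Proof.
move=> nsc bR R_max; have [RH nR _ [r0 r0R]] := blockP nsc bR.
(* A single vertex is its only block and has no parent block; both sides hold. *)
have [H1|H2] := leqP #|H| 1.
  have Hu : H = [set u] by apply/esym/eqP; rewrite eqEcard sub1set uH cards1.
  rewrite cliques_in_no_edge ?cards0 //; last first.
    by move=> x y; rewrite Hu !inE => /eqP-> /eqP->; rewrite e_irr.
  rewrite Hu setDv big_set0; split=> // _ B P /andP[/and4P[]].
  rewrite -Hu => /(blockP nsc)[PH _ _ [a aP]] /(blockP nsc)[BH _ _ [b bB]] /negP[].
  have all1 (X : {set T}) x : X \subset H -> x \in X -> X = [set u].
    move=> XH xX; apply/eqP; rewrite eqEcard -Hu XH Hu cards1.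
    by apply/card_gt0P; exists x.
  by rewrite (all1 _ _ PH aP) (all1 _ _ BH bB).
rewrite (parent_dominated_iff e_sym e_irr nsc s_ge2 H2 bR R_max r0R sH).
have r0H := subsetP RH _ r0R.
rewrite !sum_setD1 //; have -> // : circ e H r0 = circ e H u.
by apply/eqP; rewrite eqn_leq u_max // (max_block_circ e_sym e_irr nsc H2 R_max bR r0R).
Qed.

Lemma cliques_in_eq_iff :
  (#|cliques_in e s H|%:R = \sum_(v in H :\ u) w (circ e H v))%R <->
  parent_dominated_block_graph e H.
Proof.
split=> [eqH|[/all_nonsep_clique_block_graph nsc [H0|[R [bR R_max dom]]]]].
- have nsc := cliques_in_eq e_sym e_irr s_ge2 uH sH u_max eqH.
  split; first exact/all_nonsep_clique_block_graph.
  right; have [R bR R_max] := max_block_exists; exists R; split=> //.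
  exact/(parent_dominated_rooted nsc bR R_max).
- by move: uH; rewrite H0 inE.
exact/(parent_dominated_rooted nsc bR R_max).
Qed.

End BlockGraphEquality.

(** * Restriction to the vertices with large cycles *)

Section LargeCycles.
Variables (T : finType) (e : rel T) (s : nat).
Hypotheses (e_sym : symmetric e) (s_ge2 : 2 <= s).
Let H := [set v | s <= longest_cycle e v].

(** All vertices of a longest cycle through [v] have at least its length as their value, so the
    cycle stays in [H]. *)
Lemma circ_large v : v \in H -> circ e H v = longest_cycle e v.
Proof.
rewrite inE => sv; apply/eqP; rewrite eqn_leq; apply/andP; split.
  have := circ_ge2 e H v; rewrite leq_eqVlt => /predU1P[<-|/circ_witness[p [cp _ vp <-]]].
    exact: longest_cycle_ge2.
  exact: longest_cycle_max.
have [->|[p [cp vp sp]]] := longest_cycleP e v; first exact: circ_ge2.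
rewrite -sp; apply: circ_max => // x xp; rewrite inE (leq_trans sv) // -sp.
exact: longest_cycle_max.
Qed.

Lemma clique_large Q : clique e Q -> #|Q| = s -> Q \subset H.
Proof.
move=> cQ sQ; apply/subsetP => x xQ; rewrite inE.
have [s2|s3] := leqP s 2; first exact: leq_trans s2 (longest_cycle_ge2 _ _).
have [|p [cp pQ sp]] := clique_graph_cycle cQ; first by rewrite sQ.
by rewrite -sQ -sp; apply: longest_cycle_max => //; rewrite pQ.
Qed.

Lemma num_complete_large : num_complete e s = #|cliques_in e s H|.
Proof.
apply: eq_card => Q; rewrite !inE; apply/idP/and3P => [/andP[cQ sQ]|[_ -> ->//]].
by split=> //; apply: clique_large => //; apply/eqP.
Qed.

Lemma clique_bound_large u : u \in H ->
  clique_bound e s u = (\sum_(v in H :\ u) clique_weight s (circ e H v))%R.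
Proof.
move=> uH; rewrite sum_setD1 // circ_large // /clique_bound; congr (_ - _)%R.
rewrite (bigID [in H]) /= [X in (_ + X)%R]big1 ?addr0 => [|v].
  by apply: eq_bigr => v vH; rewrite circ_large.
by rewrite inE -ltnNge; exact: clique_weight_small.
Qed.

Lemma clique_bound_empty u : H = set0 -> clique_bound e s u = 0%R.
Proof.
move=> H0; have small v : clique_weight s (longest_cycle e v) = 0%R.
  by apply: clique_weight_small; rewrite ltnNge; have := in_set0 v; rewrite -H0 inE => ->.
by rewrite /clique_bound big1 ?small ?subr0.
Qed.

End LargeCycles.

(** * The case [s = 1] *)

Section SingleVertices.
Variables (T : finType) (e : rel T) (u : T).
Hypothesis u_max : longest_cycle e u = \max_v longest_cycle e v.
Local Notation c := (longest_cycle e).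

Lemma longest_cycle_le_max v : c v <= c u.
Proof. by rewrite u_max; exact: leq_bigmax. Qed.

Lemma num_complete1 : num_complete e 1 = #|T|.
Proof.
rewrite /num_complete -cardsT -(card_imset _ (@set1_inj T)); apply: eq_card => Q.
rewrite !inE; apply/andP/imsetP => [[_ /cards1P[x ->]]|[x _ ->]]; first by exists x.
rewrite cards1; split=> //.
by apply/cliqueP => a b; rewrite !inE => /eqP-> /eqP->; rewrite eqxx.
Qed.

Lemma clique_weight1 k : 2 <= k -> clique_weight 1 k = (1 + k.-1%:R^-1)%R.
Proof.
move=> k2; rewrite /clique_weight bin1 natr_subr1; last exact: ltnW.
have k0 : (k.-1%:R != 0 :> rat)%R by rewrite pnatr_eq0 -lt0n; case: k k2 => [|[]].
by rewrite -{1}(prednK (ltnW k2)) -addn1 natrD mulrDl mulfV // div1r.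
Qed.

Lemma clique_weight1_anti k l : 2 <= k -> k <= l -> (clique_weight 1 l <= clique_weight 1 k)%R.
Proof.
move=> k2 kl; rewrite !clique_weight1 ?(leq_trans k2) // lerD2l lef_pV2 ?ler_nat ?posrE ?ltr0n; lia.
Qed.

(** For [s = 1] the weight [1 + 1/(k - 1)] decreases in [k], so [u] has the smallest weight. *)
Lemma clique_bound1_ge : (#|T|.-1%:R * clique_weight 1 (c u) <= clique_bound e 1 u)%R.
Proof.
rewrite /clique_bound (bigD1 u) //= addrAC subrr add0r.
rewrite mulr_natl (_ : #|T|.-1 = #|[pred v | v != u]|); last by rewrite cardC1.
rewrite -sumr_const; apply: ler_sum => v _.
by apply: clique_weight1_anti; rewrite ?longest_cycle_ge2 ?longest_cycle_le_max.
Qed.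

(** With [n = |T|], the lower bound [(n - 1) * (1 + 1/(c u - 1))] is at least [n] because
    [c u <= n]. For one vertex the bound would be 0. *)
Lemma card_le_clique_bound1 : 2 <= #|T| -> (#|T|%:R <= clique_bound e 1 u)%R.
Proof.
move=> T2; apply: le_trans clique_bound1_ge.
have cT := longest_cycle_le_card e u T2; have c2 := longest_cycle_ge2 e u.
rewrite clique_weight1 // mulrDr mulr1 -[X in (X%:R <= _)%R](prednK (ltnW T2)) -addn1 natrD lerD2l.
by rewrite ler_pdivlMr ?ltr0n ?mul1r ?ler_nat; lia.
Qed.

(** Equality forces [c u = |T|]. On two vertices this holds through the default value 2, without a
    Hamiltonian cycle. *)
Lemma clique_bound1_eq : #|T| <> 2 ->
  (#|T|%:R = clique_bound e 1 u)%R <-> hamiltonian e.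
Proof.
move=> T2; have T0 : 0 < #|T| by apply/card_gt0P; exists u.
split=> [eqT|[p [cp pT]]].
  have [T1|{}T2'] := leqP #|T| 1.
    have cT : #|T| = 1 by lia.
    have Tu v : v = u by have /fintype_le1P := T1; apply.
    move: eqT; rewrite cT /clique_bound (bigD1 u) //= big1 ?addr0 ?subrr => [/eqP|v]; first by rewrite oner_eq0.
    by rewrite (Tu v) eqxx.
  have c2 := longest_cycle_ge2 e u.
  have cT : #|T| <= c u.
    have := clique_bound1_ge; rewrite -eqT clique_weight1 // mulrDr mulr1.
    rewrite -[X in (_ <= X%:R)%R](prednK T0) -addn1 natrD lerD2l.
    by rewrite ler_pdivrMr ?ltr0n ?mul1r ?ler_nat; lia.
  have [|p [cp _ sp]] := @longest_cycle_witness _ e u; first by lia.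
  exists p; split=> //; case/and3P: cp => _ _ up.
  move=> v; apply: contraT => vp; have uvp : uniq (v :: p) by rewrite /= vp.
  by have := max_card [in v :: p]; rewrite (card_uniqP uvp) /= sp ltnNge cT.
have cE v : c v = #|T|.
  have p3 : 2 < size p by case/and3P: cp.
  have sp : size p = #|T|.
    by case/and3P: cp => _ _ /card_uniqP<-; apply: eq_card => x; rewrite pT.
  apply/eqP; rewrite eqn_leq longest_cycle_le_card -?sp; last exact: ltnW.
  by apply: longest_cycle_max.
have T3 : 2 <= #|T| by rewrite -(cE u) longest_cycle_ge2.
rewrite /clique_bound (bigD1 u) //= addrAC subrr add0r.
rewrite (eq_bigr (fun=> clique_weight 1 #|T|)) => [|v _]; last by rewrite cE.
rewrite sumr_const cardC1 -[RHS]mulr_natl clique_weight1 // mulrDr mulr1 mulfV; last by rewrite pnatr_eq0; lia.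
by rewrite -{1}(prednK T0) -addn1 natrD.
Qed.

End SingleVertices.

(** * The bound and its equality cases *)

Local Open Scope ring_scope.

Theorem theorem2p6 (T : finType) (e : rel T) (s : nat) (u : T)
    (e_sym : symmetric e) (e_irr : irreflexive e) (s_ge1 : (1 <= s)%N)
    (u_max : longest_cycle e u = (\max_(v : T) longest_cycle e v)%N) :
  [/\ ~ (s = 1%N /\ #|T| = 1%N) ->
        (num_complete e s)%:R <= clique_bound e s u,
      s = 1%N -> #|T| <> 2%N ->
        ((num_complete e s)%:R = clique_bound e s u <-> hamiltonian e)
    & (2 <= s)%N ->
        ((num_complete e s)%:R = clique_bound e s u <->
         parent_dominated_block_graph e
           [set v : T | (s <= longest_cycle e v)%N])].
Proof.
(* By maximality [u] lies in [H_c] as soon as that set is nonempty, so it can be the omitted vertex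
   there. *)
have uP v : v \in [set v | (s <= longest_cycle e v)%N] ->
    u \in [set v | (s <= longest_cycle e v)%N].
  by rewrite !inE => /leq_trans; apply; exact: longest_cycle_le_max.
split.
- move: s_ge1 uP; rewrite leq_eqVlt => /predU1P[<- _ T1|s_ge2 uP _].
    rewrite num_complete1 card_le_clique_bound1 //.
    have : (0 < #|T|)%N by apply/card_gt0P; exists u.
    by case: #|T| T1 => [|[|n]] // [].
  rewrite num_complete_large //.
  have [H0|/set0Pn[v /uP uH]] := eqVneq [set v | (s <= longest_cycle e v)%N] set0.
    rewrite clique_bound_empty // H0 cliques_in_no_edge ?cards0 // => x y.
    by rewrite inE.
  rewrite clique_bound_large //; exact: cliques_in_le.
- by move=> -> T2; rewrite num_complete1; exact: clique_bound1_eq.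
move=> s_ge2; rewrite num_complete_large //.
have [H0|/set0Pn[v /uP uH]] := eqVneq [set v | (s <= longest_cycle e v)%N] set0.
  rewrite clique_bound_empty // H0 cliques_in_no_edge ?cards0 //; last by move=> x y; rewrite inE.
  (* With [H_c] empty both sides of the equation are 0, and the null graph is parent-dominated by
     convention. *)
  split=> // _; split; last by left.
  apply/all_nonsep_clique_block_graph; split.
    by apply/connected_inP => x y; rewrite inE.
  by move=> X; rewrite subset0 => /eqP-> /nonseparableP[]; rewrite eqxx.
rewrite clique_bound_large //; apply: cliques_in_eq_iff => // x xH; rewrite !circ_large //.
  by rewrite inE in xH.
exact: longest_cycle_le_max.
Qed.
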